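(* There is no quartic number field $K$ such that the number of elliptic curves $E$ over $K$ with $\mathbb{Z}/2\mathbb{Z}\oplus\mathbb{Z}/12\mathbb{Z}$ isomorphic to a subgroup of $E(K)$ is positive and finite.
   Context: Elliptic curves are counted up to isomorphism over $\overline{K}$. *)

(* Defs.v *)
From HB Require Import structures.
From mathcomp Require Import all_boot all_order all_algebra all_field.
From mathcomp Require Import ring.

Set Implicit Arguments.
Unset Strict Implicit.
Unset Printing Implicit Defensive.

Import GRing.Theory.
Local Open Scope ring_scope.

(** Coefficients of the Weierstrass equation
    y^2 + a1 x y + a3 y = x^3 + a2 x^2 + a4 x + a6. *)
Record weierstrass (F : Type) := Weierstrass {
  a1 : F; a2 : F; a3 : F; a4 : F; a6 : F
}.

Section Weierstrass.
Variable F : fieldType.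
Implicit Type W : weierstrass F.

Definition b2 W := a1 W ^+ 2 + 4 * a2 W.
Definition b4 W := 2 * a4 W + a1 W * a3 W.
Definition b6 W := a3 W ^+ 2 + 4 * a6 W.
Definition b8 W :=
  a1 W ^+ 2 * a6 W + 4 * a2 W * a6 W - a1 W * a3 W * a4 W
  + a2 W * a3 W ^+ 2 - a4 W ^+ 2.

Definition discriminant W :=
  - b2 W ^+ 2 * b8 W - 8 * b4 W ^+ 3 - 27 * b6 W ^+ 2
  + 9 * b2 W * b4 W * b6 W.

(** The Weierstrass equation obtained by substituting
    x = u^2 x' + r and y = u^3 y' + s u^2 x' + t and dividing by u^6. *)
Definition change_vars (u r s t : F) W : weierstrass F :=
  {| a1 := (a1 W + 2 * s) / u;
     a2 := (a2 W - s * a1 W + 3 * r - s ^+ 2) / u ^+ 2;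
     a3 := (a3 W + r * a1 W + 2 * t) / u ^+ 3;
     a4 := (a4 W - s * a3 W + 2 * r * a2 W - (t + r * s) * a1 W
            + 3 * r ^+ 2 - 2 * s * t) / u ^+ 4;
     a6 := (a6 W + r * a4 W + r ^+ 2 * a2 W + r ^+ 3 - t * a3 W
            - t ^+ 2 - r * t * a1 W) / u ^+ 6 |}.

End Weierstrass.

Definition map_weierstrass (F G : Type) (f : F -> G) (W : weierstrass F) :
    weierstrass G :=
  {| a1 := f (a1 W); a2 := f (a2 W); a3 := f (a3 W);
     a4 := f (a4 W); a6 := f (a6 W) |}.

(** An elliptic curve over F, given by a Weierstrass model; the origin is the
    point at infinity. *)
Record elliptic_curve (F : fieldType) := EllipticCurve {
  weierstrass_of :> weierstrass F;
  discriminant_neq0 : discriminant weierstrass_of != 0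
}.

(** The point at infinity, or a point of the affine plane. *)
Inductive point (F : Type) := Infinity | Affine of F & F.
Arguments Infinity {F}.

Section GroupLaw.
Variable F : fieldType.
Implicit Types (W : weierstrass F) (P Q : point F).

Definition on_curve W P : bool :=
  if P is Affine x y then
    y ^+ 2 + a1 W * x * y + a3 W * y
      == x ^+ 3 + a2 W * x ^+ 2 + a4 W * x + a6 W
  else true.

(** The slope of the line through two affine points, or of the tangent line if
    they coincide; only used when their sum is not the point at infinity. *)
Definition slope W (x1 y1 x2 y2 : F) : F :=
  if x1 == x2 then
    (3 * x1 ^+ 2 + 2 * a2 W * x1 + a4 W - a1 W * y1)
      / (2 * y1 + a1 W * x1 + a3 W)
  else (y2 - y1) / (x2 - x1).

Definition add_point W P Q : point F :=
  match P, Q with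
  | Infinity, _ => Q
  | _, Infinity => P
  | Affine x1 y1, Affine x2 y2 =>
      if (x1 == x2) && (y2 == - y1 - a1 W * x1 - a3 W) then Infinity
      else
        let l := slope W x1 y1 x2 y2 in
        let x3 := l ^+ 2 + a1 W * l - a2 W - x1 - x2 in
        let y3 := l * (x3 - x1) + y1 in
        Affine x3 (- y3 - a1 W * x3 - a3 W)
  end.

Lemma on_curve_add W P Q :
  on_curve W P -> on_curve W Q -> on_curve W (add_point W P Q).
Proof.
case: P => [|x1 y1] //; case: Q => [|x2 y2] //= /eqP e1 /eqP e2.
case: ifP => // /negbT nopp /=; set l := slope _ _ _ _ _.
set x3 := l ^+ 2 + _ - _ - _ - _; set y3 := l * _ + _; apply/eqP.
pose f (x y : F) :=
  x ^+ 3 + a2 W * x ^+ 2 + a4 W * x + a6 W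
  - (y ^+ 2 + a1 W * x * y + a3 W * y).
have f1 : f x1 y1 = 0 by rewrite /f e1 subrr.
have f2 : f x2 y2 = 0 by rewrite /f e2 subrr.
suff f3 : f x3 y3 = 0.
  transitivity (y3 ^+ 2 + a1 W * x3 * y3 + a3 W * y3); first by ring.
  by apply/esym/subr0_eq.
have [ex|nx] := eqVneq x1 x2.
  subst x2; rewrite eqxx /= in nopp.
  have ey : y2 = y1.
    apply/eqP; rewrite -subr_eq0.
    have /eqP : (y2 - y1) * (y2 - (- y1 - a1 W * x1 - a3 W)) = 0.
      by transitivity (f x1 y1 - f x1 y2);
        [rewrite /f; ring | rewrite f1 f2 subrr].
    by rewrite mulf_eq0 => /orP[//|/eqP/subr0_eq/eqP]; rewrite (negbTE nopp).
  subst y2.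
  have d0 : 2 * y1 + a1 W * x1 + a3 W != 0.
    apply: contraNneq nopp => d; apply/eqP/subr0_eq.
    by rewrite -d; ring.
  have lE : 3 * x1 ^+ 2 + 2 * a2 W * x1 + a4 W - a1 W * y1
              - l * (2 * y1 + a1 W * x1 + a3 W) = 0.
    by rewrite /l /slope eqxx divfK // subrr.
  transitivity (f x1 y1 + (x3 - x1) *
    (3 * x1 ^+ 2 + 2 * a2 W * x1 + a4 W - a1 W * y1
              - l * (2 * y1 + a1 W * x1 + a3 W))).
    by rewrite /f /y3 /x3; ring.
  by rewrite f1 lE mulr0 addr0.
have x12 : x1 - x2 != 0 by rewrite subr_eq0.
have lE : y2 = y1 + l * (x2 - x1).
  have x21 : x2 - x1 != 0 by rewrite subr_eq0 eq_sym.
  by rewrite /l /slope (negbTE nx) divfK // addrC subrK.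
apply/(mulfI x12); rewrite mulr0.
transitivity (f x1 y1 * (x3 - x2) - f x2 y2 * (x3 - x1)).
  by rewrite /f /y3 lE /x3; ring.
by rewrite f1 f2 !mul0r subrr.
Qed.

(** The group E(F) of rational points. *)
Record rational_point (E : elliptic_curve F) := RationalPoint {
  point_of :> point F;
  point_of_on_curve : on_curve E point_of
}.

Definition add_rational_point (E : elliptic_curve F)
    (P Q : rational_point E) : rational_point E :=
  RationalPoint
    (on_curve_add (point_of_on_curve P) (point_of_on_curve Q)).

End GroupLaw.

(** A is isomorphic to a subgroup of E(F), namely the image of f. *)
Definition embeds_in_points (A : zmodType) (F : fieldType)
    (E : elliptic_curve F) : Prop :=
  exists f : A -> rational_point E,
    injective f /\ {morph f : a b / a + b >-> add_rational_point a b}.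

Definition algebraic_closure (F : fieldType) (Fbar : closedFieldType)
    (iota : {rmorphism F -> Fbar}) : Prop :=
  forall z, algebraicOver iota z.

(** E and E' become isomorphic after base change along iota: isomorphisms of
    Weierstrass curves fixing the point at infinity are exactly the admissible
    changes of variables. *)
Definition isomorphic_over (F G : fieldType) (iota : {rmorphism F -> G})
    (E E' : elliptic_curve F) : Prop :=
  exists u r s t : G, u != 0 /\
    change_vars u r s t (map_weierstrass iota E) = map_weierstrass iota E'.

(** The objects satisfying P form exactly n classes for the equivalence
    relation eqv: c is a complete list of representatives. *)
Definition number_up_to (T : Type) (eqv : T -> T -> Prop) (P : T -> Prop)
    (n : nat) : Prop :=
  exists c : 'I_n -> T,
    [/\ forall i, P (c i),
        forall i j, eqv (c i) (c j) -> i = j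
      & forall x, P x -> exists i, eqv x (c i)].

(* Main.v *)
(* The modular curve X_1(2, 12) is the elliptic curve X : y^2 = x^3 - x^2 + x: with
   t = (x - 1)^2 / (2 x), a = (x - 1/x) / 2 and b = y / x one has a^2 = t^2 + 2 t and
   b^2 = 2 t + 1, and off the 16 cusps the curve Y^2 = X (X + t^2 a^2) (X + b^2) has
   a subgroup Z/2 + Z/12; conversely every such subgroup over K comes from a
   noncuspidal K-point of X.  It suffices to show that one noncuspidal point over a
   quartic field K yields infinitely many of them, with distinct t, since a given
   j-invariant arises from finitely many t.

   Duplicate the point repeatedly.  Doubling never leads from a noncuspidal to a
   cuspidal point: the halves of the cusps would require a square in Q(zeta_8) or
   Q(sqrt 2, sqrt 3) that is not even a 2-adic square, or a square in Q(i, sqrt 3)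
   that a norm computation excludes.  Let O be a valuation ring of K at 2.  Once x
   is not in O, doubling divides x by 4 up to a unit, so the orbit is infinite.  If
   x stayed in O forever, then x - 1 would have valuation 1/2, the element
   pi = ((x - 1)^2 + 2 (x - 1) + 2) / 2 would have valuation 1/4, hence K would be
   totally ramified at 2, and y^2 = 1 + 2 pi (x - 1) would be a unit 1 + c with c of
   valuation 7/4, which is not a square. *)
Require Import Defs.
From Stdlib Require Import ZArith.
From mathcomp Require Import all_boot all_order all_algebra all_field.
From mathcomp Require Import boolp classical_sets.
From mathcomp Require Import ring zify ssrZ lra.

Set Implicit Arguments.
Unset Strict Implicit.
Unset Printing Implicit Defensive.

Import Order.TTheory GRing.Theory Num.Theory.
Local Open Scope ring_scope.

(** * Valuation rings *)

Definition is_subring (F : fieldType) (O : set F) : Prop :=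
  [/\ O 1, forall x y, O x -> O y -> O (x - y)
    & forall x y, O x -> O y -> O (x * y)].

Section Subring.
Variables (F : fieldType) (O : set F).
Hypothesis subO : is_subring O.

Lemma subring1 : O 1. Proof. by case: subO. Qed.
Lemma subringB x y : O x -> O y -> O (x - y).
Proof. by case: subO => _ + _; apply. Qed.
Lemma subringM x y : O x -> O y -> O (x * y).
Proof. by case: subO => _ _; apply. Qed.
Lemma subring0 : O 0.
Proof. by rewrite -(subrr 1); apply: subringB; apply: subring1. Qed.
Lemma subringN x : O x -> O (- x).
Proof. by rewrite -sub0r; apply: subringB; apply: subring0. Qed.
Lemma subringD x y : O x -> O y -> O (x + y).
Proof. by move=> Ox /subringN/(subringB Ox); rewrite opprK. Qed.
Lemma subringX x n : O x -> O (x ^+ n).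
Proof.
by move=> Ox; elim: n => [|n IH]; [exact: subring1|rewrite exprS; apply: subringM].
Qed.
Lemma subring_nat n : O n%:R.
Proof.
elim: n => [|n IH]; first exact: subring0.
by rewrite -addn1 natrD; apply: subringD => //; exact: subring1.
Qed.
Lemma subring_sum (I : Type) (r : seq I) (P : pred I) (f : I -> F) :
  (forall i, P i -> O (f i)) -> O (\sum_(i <- r | P i) f i).
Proof. by move=> Of; apply: big_ind => //; [exact: subring0|exact: subringD]. Qed.

Definition adjoin (x : F) : set F :=
  [set z | exists p : {poly F}, (forall i, O p`_i) /\ z = p.[x]].

Lemma adjoin_subring x : is_subring (adjoin x).
Proof.
split.
- exists 1; split=> [i|]; last by rewrite hornerC.
  by rewrite coef1; exact: subring_nat.
- move=> _ _ [p [Op ->]] [q [Oq ->]]; exists (p - q); rewrite hornerD hornerN.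
  by split=> // i; rewrite coefB; apply: subringB.
- move=> _ _ [p [Op ->]] [q [Oq ->]]; exists (p * q); rewrite hornerM.
  by split=> // i; rewrite coefM; apply: subring_sum => j _; apply: subringM.
Qed.

Lemma sub_adjoin x : (O `<=` adjoin x)%classic.
Proof.
move=> z Oz; exists z%:P; rewrite hornerC; split=> // i.
by rewrite coefC; case: ifP => // _; exact: subring0.
Qed.

Lemma mem_adjoin x : adjoin x x.
Proof.
by exists 'X; rewrite hornerX; split=> // i; rewrite coefX; exact: subring_nat.
Qed.

End Subring.

(** * Chevalley's theorem: a ring maximal among those without 1/p is a valuation ring *)

Section Chevalley.
Variables (F : fieldType) (p : F) (O : set F).
Hypotheses (p0 : p != 0) (subO : is_subring O) (Op : O p) (pVO : ~ O p^-1).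
Hypothesis maxO : forall R, is_subring R -> (O `<=` R)%classic -> ~ R p^-1 ->
  (R `<=` O)%classic.

(** The ring O[x] is strictly larger than O, so by maximality it contains 1/p. *)
Lemma maximal_adjoin x :
  ~ O x -> exists2 q : {poly F}, (forall i, O q`_i) & q.[x] = p^-1.
Proof.
move=> nOx; apply: contra_notP nOx => nq.
apply: (maxO (adjoin_subring subO x) (@sub_adjoin _ _ subO x)); last exact: mem_adjoin.
by move=> [q [Oq qE]]; apply: nq; exists q.
Qed.

(** With d = 1 - p a, if 1/d were missing, 1/p would be a polynomial in 1/d. Multiplying by a large
    power d^n clears the denominators, and d^n = 1 - p b with b in O, so 1/p itself would lie in
    O. *)
Lemma maximal_inv a : O a -> O (1 - p * a)^-1.
Proof.
move=> Oa; apply: contrapT => /maximal_adjoin[q Oq qE].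
set d := 1 - p * a in qE.
have Od : O d by apply: subringB; [| exact: subring1 | exact: subringM].
have d0 : d != 0.
  apply/eqP => /eqP; rewrite subr_eq0 => /eqP pa; apply: pVO.
  by rewrite -[p^-1]mulr1 pa mulKf.
have E n : exists2 b, O b & d ^+ n = 1 - p * b.
  elim: n => [|n [b Ob IH]].
    by exists 0; [exact: subring0|rewrite expr0 mulr0 subr0].
  exists (a + b * d); first by apply: subringD => //; apply: subringM.
  by rewrite exprS IH /d; ring.
have [b Ob Eb] := E (size q).
apply: pVO; have -> : p^-1 = b + \sum_(i < size q) q`_i * d ^+ (size q - i).
  apply: (mulfI p0); rewrite divff // mulrDr.
  transitivity (p * b + p * (q.[d^-1] * d ^+ size q)).
    by rewrite qE mulrA divff // Eb; ring.
  congr (_ + p * _); rewrite horner_coef mulr_suml; apply: eq_bigr => i _.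
  rewrite -mulrA exprVn; congr (_ * _).
  have -> : d ^+ size q = d ^+ (size q - i) * d ^+ i.
    by rewrite -exprD subnK // ltnW.
  by rewrite mulrC mulfK // expf_neq0.
apply: subringD => //; apply: subring_sum => // i _.
by apply: subringM => //; apply: subringX.
Qed.

Let span n x z := exists r : nat -> F,
  (forall i, O (r i)) /\ z = p * \sum_(i < n) r i * x ^+ i.

Let spanD n x z1 z2 : span n x z1 -> span n x z2 -> span n x (z1 + z2).
Proof.
move=> [r [Or ->]] [r' [Or' ->]]; exists (fun i => r i + r' i).
split=> [i|]; first exact: subringD.
by rewrite -mulrDr -big_split; congr (_ * _); apply: eq_bigr => i _; rewrite mulrDl.
Qed.

Let spanX n x c i : O c -> (i < n)%N -> span n x (p * (c * x ^+ i)).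
Proof.
move=> Oc ltin; exists (fun k => if k == i then c else 0).
split=> [k|]; first by case: ifP => // _; exact: subring0.
rewrite (bigD1 (Ordinal ltin)) //= eqxx big1 ?addr0 // => j ji.
by rewrite ifN ?mul0r.
Qed.

Let span_sum n x m (f : nat -> F) :
  (forall i, (i < m)%N -> span n x (f i)) -> span n x (\sum_(i < m) f i).
Proof.
move=> Sf; apply: big_ind => [||i _]; last exact: Sf.
  exists (fun=> 0); split=> [i|]; first exact: subring0.
  by rewrite big1 ?mulr0 // => i _; rewrite mul0r.
exact: spanD.
Qed.

(** Of the two relations 1 = p (polynomial in x) and 1 = p (polynomial in 1/x), the shorter one
    serves to remove the top power from the longer one. The total length drops until one of them
    reads 1 = 0. *)
Let span_absurd k n m x : x != 0 -> (n + m <= k)%N ->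
  span n x 1 -> span m x^-1 1 -> False.
Proof.
elim: k n m x => [|k IH] n m x x0 nmk Sn Sm.
  case: n nmk Sn => // _ [r [_ /eqP]].
  by rewrite big_ord0 mulr0 oner_eq0.
wlog mn : n m x x0 nmk Sn Sm / (m <= n)%N.
  move=> W; have [mn|/ltnW nm] := leqP m n; first exact: (W n m x).
  by apply: (W m n x^-1); rewrite ?invr_eq0 ?invrK 1?addnC.
case: m Sm mn nmk => [[r [_ /eqP]]|m [q [Oq qE]]].
  by rewrite big_ord0 mulr0 oner_eq0.
case: n Sn => // n [r [Or rE]] mn nmk.
apply: (IH n m.+1 x x0); [by rewrite addSn in nmk| |by exists q].
set e := (1 - p * q 0%N)^-1; have Oe : O e by apply: maximal_inv.
have e0 : 1 - p * q 0%N != 0.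
  apply/eqP => /eqP; rewrite subr_eq0 => /eqP pa; apply: pVO.
  by rewrite -[p^-1]mulr1 pa mulKf.
(* The relation in 1/x is multiplied by x^n, its constant term is moved to the left, and the result
   is divided by the unit 1 - p q_0. *)
have xE : x ^+ n = \sum_(j < m) p * (e * q j.+1 * x ^+ (n - j.+1)).
  apply: (mulfI e0).
  have -> : (1 - p * q 0%N) * x ^+ n = p * (\sum_(j < m) q j.+1 * x^-1 ^+ j.+1) * x ^+ n.
    congr (_ * _); rewrite {1}qE big_ord_recl expr0 mulr1 mulrDr addrC addKr.
    by congr (_ * _); apply: eq_bigr => i _.
  rewrite -mulrA mulr_suml !mulr_sumr; apply: eq_bigr => j _.
  have -> : x ^+ n = x ^+ (n - j.+1) * x ^+ j.+1.
    by rewrite -exprD subnK //; apply: leq_trans (ltn_ord j) _.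
  by rewrite /e; move: (x ^+ (n - _)) => y; rewrite exprVn; field; rewrite e0 expf_neq0.
rewrite rE big_ord_recr /= mulrDr; apply: spanD; first by exists r.
rewrite xE mulr_sumr mulr_sumr.
apply: (span_sum (f := fun j => p * (r n * (p * (e * q j.+1 * x ^+ (n - j.+1)))))) => j jm.
have -> : p * (r n * (p * (e * q j.+1 * x ^+ (n - j.+1))))
  = p * ((r n * p * e * q j.+1) * x ^+ (n - j.+1)) by ring.
apply: spanX; last by lia.
by do !apply: subringM => //.
Qed.

Lemma maximal_total x : O x \/ O x^-1.
Proof.
apply: contrapT => /not_orP[nx nxV].
have x0 : x != 0 by apply/eqP => E; apply: nx; rewrite E; exact: subring0.
have S y : ~ O y -> exists n, span n y 1.
  move=> /maximal_adjoin[q Oq qE]; exists (size q), (nth 0 q); split=> //.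
  by rewrite -horner_coef qE divff.
have [n Sn] := S _ nx; have [m Sm] := S _ nxV.
exact: (@span_absurd (n + m) n m x).
Qed.

End Chevalley.

Definition is_valuation_ring (F : fieldType) (O : set F) : Prop :=
  is_subring O /\ forall x, O x \/ O x^-1.

(** Zorn's lemma provides a maximal ring above [R0] without 1/p, to which Chevalley's theorem
    applies. *)
Lemma exists_valuation_ring (F : fieldType) (p : F) (R0 : set F) :
  p != 0 -> is_subring R0 -> R0 p -> ~ R0 p^-1 ->
  exists O : set F, [/\ is_valuation_ring O, O p & ~ O p^-1].
Proof.
move=> p0 subR0 R0p R0pV.
(* Only nonempty sets are asked to contain [R0], so that the empty set, the union of the empty
   chain, satisfies [P]. A maximal set is nonempty, since otherwise [R0] would be larger. *)
pose P (R : set F) := [/\ forall x, R x -> (R0 `<=` R)%classic,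
  forall x y, R x -> R y -> R (x - y) /\ R (x * y) & ~ R p^-1].
have [|O [[O0 Ocl OpV] maxO]] := @Zorn_bigcup F P.
  move=> C CP Ctot; split=> [x [A CA Ax] z R0z|x y [A CA Ax] [B CB By]|[A /CP[]//]].
    by exists A => //; have [sub _ _] := CP _ CA; exact: sub Ax z R0z.
  have [AB|BA] := Ctot _ _ CA CB.
    have [_ cl _] := CP _ CB; have [? ?] := cl x y (AB _ Ax) By.
    by split; exists B.
  have [_ cl _] := CP _ CA; have [? ?] := cl x y Ax (BA _ By).
  by split; exists A.
have maxO' R : is_subring R -> (R0 `<=` R)%classic -> (O `<=` R)%classic -> ~ R p^-1 ->
    (R `<=` O)%classic.
  move=> subR R0R OR RpV x Rx; apply: contrapT => nOx.
  apply: (maxO R); last first.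
    by split=> // y z Ry Rz; split; [exact: subringB|exact: subringM].
  by split=> // /(_ x Rx).
have R0O : (R0 `<=` O)%classic.
  have [[x Ox]|nO] := pselect (exists x, O x); first exact: O0 Ox.
  by apply: maxO' => // z Oz; case: nO; exists z.
have subO : is_subring O.
  split; first by apply: R0O; case: subR0.
    by move=> x y Ox Oy; case: (Ocl x y Ox Oy).
  by move=> x y Ox Oy; case: (Ocl x y Ox Oy).
exists O; split=> //; last exact: R0O.
split=> // x; apply: (maximal_total p0 subO) => // [|R subR OR RpV].
  exact: R0O.
by apply: maxO' => // z /R0O/OR.
Qed.

(** * Units, the maximal ideal, and valuations in quarters at 2 *)

Section ValuationRing.
Variables (F : fieldType) (O : set F).
Hypothesis valO : is_valuation_ring O.

Let subO : is_subring O. Proof. by case: valO. Qed.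

Definition vunit (x : F) : Prop := [/\ x != 0, O x & O x^-1].
Definition vmax (x : F) : Prop := O x /\ ~ vunit x.

Lemma vunit1 : vunit 1.
Proof. by split; rewrite ?oner_eq0 ?invr1 //; exact: subring1. Qed.

Lemma vunitM x y : vunit x -> vunit y -> vunit (x * y).
Proof.
move=> [x0 Ox OxV] [y0 Oy OyV].
by split; rewrite ?mulf_neq0 ?invfM //; exact: subringM.
Qed.

Lemma vunitV x : vunit x -> vunit x^-1.
Proof. by move=> [x0 Ox OxV]; split; rewrite ?invr_eq0 ?invrK. Qed.

Lemma vunitN x : vunit x -> vunit (- x).
Proof. by move=> [x0 Ox OxV]; split; rewrite ?oppr_eq0 ?invrN //; exact: subringN. Qed.

Lemma vunitX x n : vunit x -> vunit (x ^+ n).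
Proof.
by move=> ux; elim: n => [|n IH]; [exact: vunit1|rewrite exprS; exact: vunitM].
Qed.

Lemma vunit_root x n : vunit (x ^+ n.+1) -> vunit x.
Proof.
move=> [xn0 Oxn OxnV].
have x0 : x != 0 by move: xn0; rewrite expf_eq0.
have [_ /(_ x)[Ox|OxV]] := valO; split=> //.
  have -> : x^-1 = (x ^+ n.+1)^-1 * x ^+ n.
    by rewrite exprS; field; rewrite x0 expf_neq0.
  by apply: subringM => //; apply: subringX.
have -> : x = x ^+ n.+1 * x^-1 ^+ n.
  by rewrite exprS exprVn mulfK // expf_neq0.
by apply: subringM => //; apply: subringX.
Qed.

Lemma vmax0 : vmax 0.
Proof. by split; [exact: subring0|case; rewrite eqxx]. Qed.

Lemma vmaxE x : O x -> x != 0 -> ~ O x^-1 -> vmax x.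
Proof. by move=> Ox x0 OxV; split=> // -[]. Qed.

Lemma vmax_inv x : ~ O x -> vmax x^-1.
Proof.
move=> Ox; have [_ /(_ x)[//|OxV]] := valO.
by split=> // -[_ _]; rewrite invrK.
Qed.

Lemma vmaxMl x y : O x -> vmax y -> vmax (x * y).
Proof.
move=> Ox [Oy ny]; split; first exact: subringM.
move=> [xy0 _ OxyV]; apply: ny; move: xy0; rewrite mulf_eq0 negb_or => /andP[x0 y0].
split=> //; have -> : y^-1 = x * (x * y)^-1 by rewrite invfM mulrA divff ?mul1r.
exact: subringM.
Qed.

Lemma vmaxD x y : vmax x -> vmax y -> vmax (x + y).
Proof.
wlog Oxy : x y / O (x / y) => [W mx my|mx my].
  have [_ /(_ (x / y))[|]] := valO; first by move/W; apply.
  by rewrite invf_div addrC => /W; apply.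
have [->|y0] := eqVneq y 0; first by rewrite addr0.
have -> : x + y = (x / y + 1) * y by rewrite mulrDl divfK // mul1r.
by apply: vmaxMl => //; apply: subringD => //; exact: subring1.
Qed.

Lemma vmaxN x : vmax x -> vmax (- x).
Proof.
rewrite -mulN1r; apply: vmaxMl; apply: subringN => //; exact: subring1.
Qed.

Lemma vunitDm x y : vunit x -> vmax y -> vunit (x + y).
Proof.
move=> ux my; apply: contrapT => nu.
have : vmax (x + y) by split=> //; apply: subringD => //; [case: ux|case: my].
by move=> /vmaxD/(_ (vmaxN my)); rewrite addrK => -[].
Qed.

Lemma vmax_root x n : vmax (x ^+ n.+1) -> vmax x.
Proof.
move=> mxn; have [->|x0] := eqVneq x 0; first exact: vmax0.
have [_ /(_ x)[Ox|OxV]] := valO.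
  by split=> // ux; case: mxn => _; apply; exact: vunitX.
have : vunit (x ^+ n.+1 * x^-1 ^+ n.+1).
  by rewrite -exprMn divff // expr1n; exact: vunit1.
rewrite mulrC => u; have [|_ []//] := @vmaxMl (x^-1 ^+ n.+1) (x ^+ n.+1) _ mxn.
exact: subringX.
Qed.

Hypotheses (O2 : O 2) (O2V : ~ O 2^-1) (two0 : 2 != 0 :> F).

Lemma vmax2 : vmax 2. Proof. exact: vmaxE. Qed.

(* [level k x] says that x has valuation k / 4, normalised so that 2 has
   valuation 1. *)
Definition level (k : int) (x : F) : Prop := vunit (x ^+ 4 / 2 ^ k).

Lemma level_neq0 k x : level k x -> x != 0.
Proof. by move=> [+ _ _]; apply: contraNneq => ->; rewrite expr0n mul0r. Qed.

Lemma level_unit x : vunit x -> level 0 x.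
Proof. by rewrite /level expr0z divr1; exact: vunitX. Qed.

Lemma levelM k l x y : level k x -> level l y -> level (k + l) (x * y).
Proof.
rewrite /level => ux uy; have := vunitM ux uy.
by rewrite mulrACA -exprMn -invfM -expfzDr.
Qed.

Lemma levelV k x : level k x -> level (- k) x^-1.
Proof. by move=> /vunitV; rewrite /level exprVn invf_div invr_expz opprK mulrC. Qed.

Lemma levelX k x n : level k x -> level (k * n%:Z) (x ^+ n).
Proof.
move=> lx; elim: n => [|n IH]; first by rewrite mulr0; apply/level_unit/vunit1.
by rewrite exprS (_ : _ * _ = k + k * n%:Z) ?intS; [exact: levelM|ring].
Qed.

Lemma level2 : level 4 2.
Proof. by rewrite /level -exprnP divff ?expf_neq0 //; exact: vunit1. Qed.

Lemma vmax_level k x : 0 < k -> level k x -> vmax x.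
Proof.
case: k => // -[//|k] _; rewrite /level -exprnP => u.
apply: (@vmax_root _ 3); have -> : x ^+ 4 = (x ^+ 4 / 2 ^+ k.+1 * 2 ^+ k) * 2.
  by rewrite -mulrA -exprSr divfK // expf_neq0.
apply: vmaxMl vmax2; apply: subringM => //; last exact: subringX.
by case: u.
Qed.

Lemma level_uniq k l x : level k x -> level l x -> k = l.
Proof.
wlog lt_kl : k l / k < l => [W lk ll|lk ll].
  by have [/W->|/W->|] := ltgtP k l.
have x0 := level_neq0 lk.
have [_ []] : vmax 1; last exact: vunit1.
apply: (@vmax_level (l - k)); first by rewrite subr_gt0.
by rewrite -(divff x0); apply: levelM => //; exact: levelV.
Qed.

Lemma levelD k l x y : k < l -> level k x -> level l y -> level k (x + y).
Proof.
move=> lt_kl lx ly; have x0 := level_neq0 lx.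
have -> : x + y = x * (1 + y / x) by rewrite mulrDr mulr1 mulrC divfK.
rewrite -[k]addr0; apply: levelM => //; apply: level_unit.
apply: vunitDm; first exact: vunit1.
apply: (@vmax_level (l - k)); first by rewrite subr_gt0.
by apply: levelM => //; exact: levelV.
Qed.

Lemma levelN k x : level k x -> level k (- x).
Proof. by rewrite /level exprNn -signr_odd mul1r. Qed.

Lemma vunit_odd n : odd n -> vunit (n%:R : F).
Proof.
move=> odd_n; rewrite -(odd_double_half n) odd_n natrD.
apply: vunitDm; first exact: vunit1.
rewrite -muln2 natrM; apply: vmaxMl vmax2; exact: subring_nat.
Qed.

Lemma level_nat n : (0 < n)%N -> exists k : int, level (4 * k) (n%:R : F).
Proof.
move=> n0; exists (logn 2 n)%:Z.
have [m co_m nE] := pfactor_coprime (p := 2) isT n0.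
have -> : n%:R = 2 ^+ logn 2 n * m%:R :> F by rewrite -natrX -natrM mulnC -nE.
rewrite -[4 * _]addr0; apply: levelM; first exact: levelX level2.
by apply/level_unit/vunit_odd; rewrite -coprime2n.
Qed.

(* If z^2 = 1 + c, then c = (z - 1) (z - 1 + 2) has an even level below 8, or level at
   least 8. *)
Lemma not_square_level (z c : F) (k : nat) :
  (forall x : F, x != 0 -> exists l, level l x) ->
  (k < 4)%N -> level (k.*2.+1)%:Z c -> z ^+ 2 != 1 + c.
Proof.
move=> lev k4 lc; apply/eqP => zE.
have cE : c = (z - 1) * (z - 1 + 2) by transitivity (z ^+ 2 - 1); [rewrite zE|]; ring.
have := level_neq0 lc; rewrite cE mulf_eq0 negb_or => /andP[z0 z20].
have [l lz] := lev _ z0; have [m lz2] := lev _ z20.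
have /level_uniq/(_ lc) E : level (l + m) c by rewrite cE; exact: levelM.
have [l4|l4|l4] := ltgtP l 4.
- have := level_uniq lz2 (levelD l4 lz level2); lia.
- have := levelD l4 level2 lz; rewrite addrC => /(level_uniq lz2); lia.
have [m4|m4|m4] := ltgtP m 4; [|lia|lia].
have := levelD m4 lz2 (levelN level2); rewrite addrK => /(level_uniq lz); lia.
Qed.

End ValuationRing.

(** * Quartic fields *)

Section QuarticField.
Variable K : fieldExtType rat.

Lemma fieldExt_rat_natr_eq0 n : (n%:R == 0 :> K) = (n == 0)%N.
Proof. by move: n; apply/pcharf0P => p; rewrite pchar_lalg pchar_num. Qed.

Let two0 : 2 != 0 :> K. Proof. by rewrite fieldExt_rat_natr_eq0. Qed.

(** The starting ring is the image of the integers, where 2 k = 1 has no solution. *)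
Lemma exists_2adic_ring :
  exists O : set K, [/\ is_valuation_ring O, O 2 & ~ O 2^-1].
Proof.
apply: (@exists_valuation_ring _ _ [set z | exists k : int, z = k%:~R]%classic) => //.
- split; first by exists 1.
  + by move=> _ _ [k ->] [l ->]; exists (k - l); rewrite rmorphB.
  by move=> _ _ [k ->] [l ->]; exists (k * l); rewrite rmorphM.
- by exists 2.
move=> [k kE]; have : (2 * k - 1)%:~R = 0 :> K.
  by rewrite rmorphB rmorphM /= -kE divff // subrr.
have nz (m : nat) : m%:~R = 0 :> K -> m = 0%N.
  by move/eqP; rewrite -pmulrn fieldExt_rat_natr_eq0 => /eqP.
case E : (2 * k - 1) => [m|m]; first by move/nz; lia.
by rewrite NegzE rmorphN /= => /eqP; rewrite oppr_eq0 => /eqP/nz.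
Qed.

Hypothesis dimK : \dim {:K} = 4%N.

Lemma free_span (e : 4.-tuple K) : free e ->
  forall z, exists a : 'I_4 -> rat, z = \sum_(i < 4) a i *: e`_i.
Proof.
move=> fe z; have be : basis_of {:K} e.
  by rewrite basisEfree fe subvf size_tuple dimK.
by exists (fun i => coord e i z); apply: (coord_basis be); exact: memvf.
Qed.

(** * Valuations in a totally ramified quartic field *)

Section Level.
Variable O : set K.
Hypotheses (valO : is_valuation_ring O) (O2 : O 2) (O2V : ~ O 2^-1).

Lemma level_rat (a : rat) : a != 0 -> exists k : int, level O (4 * k) (a%:A : K).
Proof.
have lev_int (m : int) : m != 0 -> exists k : int, level O (4 * k) (m%:~R : K).
  case: m => n n0; first by apply: level_nat => //; rewrite lt0n.
  have [|k lk] := @level_nat _ _ valO O2 O2V two0 n.+1 => //.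
  by exists k; rewrite NegzE rmorphN; exact: levelN.
move=> a0; have [|k lk] := lev_int (numq a); first by rewrite numq_eq0.
have [l ll] := lev_int (denq a) (denq_neq0 a).
exists (k - l); rewrite mulrBr.
have -> : a%:A = (numq a)%:~R / (denq a)%:~R :> K.
  have inA (m : int) : m%:~R%:A = m%:~R :> K by rewrite -[LHS]/(in_alg K _) rmorph_int.
  by rewrite -[a in LHS]divq_num_den -[LHS]/(in_alg K _) fmorph_div /= !inA.
by apply: levelM => //; exact: levelV.
Qed.

(* The terms of the sum have valuations in distinct classes modulo 4. *)
Lemma level_sum (p : K) (a : nat -> rat) n : level O 1 p -> (n <= 4)%N ->
  (forall i, (i < n)%N -> a i = 0) \/
  exists k : int, exists2 i, (i < n)%N & level O (4 * k + i%:Z) (\sum_(j < n) a j *: p ^+ j).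
Proof.
move=> lp; elim: n => [|n IH] n4; first by left.
have [an0|an0] := eqVneq (a n) 0.
  have [a0|[k [i lt_in lk]]] := IH (ltnW n4).
    by left=> i; rewrite ltnS leq_eqVlt => /predU1P[->|/a0].
  right; exists k, i; first exact: ltnW.
  by rewrite big_ord_recr /= an0 scale0r addr0.
have [l ll] := level_rat an0; right.
have lan : level O (4 * l + n%:Z) (a n *: p ^+ n).
  rewrite -[_ ^+ n]mul1r scalerAl; apply: levelM => //.
  by rewrite -[n%:Z]mul1r; exact: levelX.
have [a0|[k [i lt_in lk]]] := IH (ltnW n4).
  exists l, n => //; rewrite big_ord_recr /= big1 ?add0r // => i _.
  by rewrite a0 // scale0r.
rewrite big_ord_recr /=.
have [lt|lt|] := ltgtP (4 * k + i%:Z) (4 * l + n%:Z); last lia.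
  by exists k, i; [lia|exact: levelD lk lan].
by exists l, n => //; rewrite addrC; exact: levelD lan lk.
Qed.

(** Rational numbers have integral valuation, so 1, p, p^2, p^3 have valuations distinct modulo 1.
    They are therefore independent over the rationals and form a basis of K, and in any combination
    a single term has the least valuation. *)
Lemma level_exists (p : K) : level O 1 p -> forall z : K, z != 0 -> exists k, level O k z.
Proof.
move=> lp; pose e := [tuple p ^+ i | i < 4].
have eE i : (i < 4)%N -> e`_i = p ^+ i.
  by move=> i4; rewrite (nth_mktuple _ _ (Ordinal i4)).
have sumE (a : 'I_4 -> rat) :
    \sum_(i < 4) a i *: e`_i = \sum_(i < 4) a (inord i) *: p ^+ i.
  by apply: eq_bigr => i _; rewrite inord_val eE.
have fe : free e.
  apply/freeP => a; rewrite sumE => a0 i.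
  have [//|/(_ i)|[k [j _ /level_neq0]]] := @level_sum p (fun i => a (inord i)) 4 lp.
    by rewrite inord_val; apply.
  by rewrite a0 eqxx.
move=> z z0; have [a zE] := free_span fe z; rewrite zE sumE.
have [//|a0|[k [i _ lk]]] := @level_sum p (fun i => a (inord i)) 4 lp.
  by move: z0; rewrite zE sumE big1 ?eqxx // => i _; rewrite a0 ?scale0r.
by exists (4 * k + i%:Z).
Qed.

End Level.

Lemma sqr_rat_neq3 (a : rat) : a ^+ 2 <> 3.
Proof.
move=> aE; have : numq a ^+ 2 = 3 * denq a ^+ 2.
  apply: (@intr_inj rat); rewrite rmorphXn rmorphM rmorphXn /=.
  transitivity (a ^+ 2 * (denq a)%:~R ^+ 2); last by rewrite aE.
  by rewrite -exprMn -{2}[a]divq_num_den divfK // intr_eq0 denq_eq0.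
move: (coprime_num_den a) => + /(congr1 absz).
rewrite abszM !abszX /= => co E.
have /andP[d3 _] : (3 %| `|numq a|)%N && (0 < 2)%N.
  by rewrite -Euclid_dvdX // E dvdn_mulr.
have /andP[d3' _] : (3 %| `|denq a|)%N && (0 < 2)%N.
  by rewrite -Euclid_dvdX // -(@dvdn_pmul2l 3) // -E (@dvdn_exp2r 3 _ 2).
by have : (3 %| gcdn `|numq a| `|denq a|)%N; [rewrite dvdn_gcd d3 d3'|rewrite (eqP co)].
Qed.

(** * Nonsquares in the biquadratic field generated by i and the square root of 3 *)

Section Sqrt3.
Variables (f : {rmorphism rat -> K}) (h : K).
Hypothesis hE : h ^+ 2 = 3.

Lemma sqrt3_free (a b : rat) : f a + f b * h = 0 -> a = 0 /\ b = 0.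
Proof.
move=> ab; have E : a ^+ 2 = b ^+ 2 * 3.
  apply: (fmorph_inj f); rewrite rmorphXn rmorphM rmorphXn rmorph_nat -hE.
  by apply/eqP; rewrite -exprMn -subr_eq0 subr_sqr ab mulr0.
have [b0|b0] := eqVneq b 0.
  by move: E; rewrite b0 expr0n mul0r => /eqP; rewrite sqrf_eq0 => /eqP.
by case: (@sqr_rat_neq3 (a / b)); rewrite expr_div_n E mulrC mulKf // expf_neq0.
Qed.

Variable i : K.
Hypothesis iE : i ^+ 2 = -1.

(** Write the relation as A + i B = 0 with A, B in Q(h), so A^2 + B^2 = 0. Multiplying by the square
    of the conjugate of B gives (P + Q h)^2 + N^2 = 0 with N the norm of B. Its rational part is a
    sum of squares, so N = 0 and B = 0. *)
Lemma sqrt3_i_free (a b c d : rat) :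
  (f a + f b * h) + i * (f c + f d * h) = 0 -> [/\ a = 0, b = 0, c = 0 & d = 0].
Proof.
move=> E; pose N := c ^+ 2 - 3 * d ^+ 2.
pose P := a * c - 3 * b * d; pose Q := b * c - a * d.
have [E1 _] : P ^+ 2 + 3 * Q ^+ 2 + N ^+ 2 = 0 /\ 2 * P * Q = 0.
  apply: sqrt3_free; rewrite /P /Q /N.
  have E1 : f a + f b * h = - i * (f c + f d * h) by apply/eqP; rewrite -subr_eq0 mulNr opprK E.
  transitivity (((f a + f b * h) ^+ 2 - (i * (f c + f d * h)) ^+ 2)
      * (f c - f d * h) ^+ 2).
    by ring: hE iE.
  by rewrite E1 mulNr sqrrN subrr mul0r.
have N0 : N = 0 by apply/eqP; rewrite -sqrf_eq0; apply/eqP; nra.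
have [c0 d0] : c = 0 /\ d = 0.
  have /eqP : (f c + f d * h) * (f c - f d * h) = 0.
    transitivity (f N); last by rewrite N0 rmorph0.
    by rewrite /N; ring: hE.
  rewrite mulf_eq0 => /orP[/eqP/sqrt3_free//|/eqP].
  by rewrite -mulNr -rmorphN => /sqrt3_free[-> /eqP]; rewrite oppr_eq0 => /eqP.
by move: E; rewrite c0 d0 rmorph0 mul0r !addr0 mulr0 addr0 => /sqrt3_free[-> ->].
Qed.
End Sqrt3.

Section Biquadratic.
Variables i h : K.
Hypotheses (iE : i ^+ 2 = -1) (hE : h ^+ 2 = 3).

Lemma sqrt3_i_span (z : K) : exists (f : {rmorphism rat -> K}) (a b c d : rat),
  z = (f a + f b * h) + i * (f c + f d * h).
Proof.
pose e := [tuple 1; h; i; i * h].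
have sumE (a : 'I_4 -> rat) : \sum_(j < 4) a j *: e`_j =
    ((a (inord 0))%:A + (a (inord 1))%:A * h)
    + i * ((a (inord 2))%:A + (a (inord 3))%:A * h).
  rewrite (eq_bigr (fun j : 'I_4 => a (inord j) *: e`_j)) => [|j _]; last first.
    by rewrite inord_val.
  rewrite !big_ord_recl big_ord0 /= /bump /= addr0.
  by rewrite -(mulr_algl _ h) -(mulr_algl _ i) -(mulr_algl _ (i * h)); ring.
have fe : free e.
  apply/freeP => a; rewrite sumE => /(@sqrt3_i_free (in_alg K) _ hE _ iE)[a0 a1 a2 a3] j.
  rewrite -[j]inord_val.
  by case: j => -[|[|[|[|//]]]] /= _.
have [a ->] := free_span fe z.
by exists (in_alg K), (a (inord 0)), (a (inord 1)), (a (inord 2)), (a (inord 3)).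
Qed.

(** For s = A + i B, comparing parts gives A^2 = B^2 and 2 A B = h. With B = A or B = -A, the
    rational part of A B is a^2 + 3 b^2 up to sign; it must vanish, so s = 0. *)
Lemma sqr_neq_iM (s : K) : s ^+ 2 <> i * h.
Proof.
have [f [a [b [c [d sE]]]]] := sqrt3_i_span s => E.
have [E1 E2 E3 E4] : [/\ a ^+ 2 + 3 * b ^+ 2 - (c ^+ 2 + 3 * d ^+ 2) = 0,
     2 * a * b - 2 * c * d = 0,
     2 * (a * c + 3 * b * d) = 0 & 2 * (a * d + b * c) - 1 = 0].
  apply: (sqrt3_i_free hE iE (f := f)).
  rewrite -(subrr (s ^+ 2)) {2}E sE.
  by ring: hE iE.
have /eqP : (f (a - c) + f (b - d) * h) * (f (a + c) + f (b + d) * h) = 0.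
  transitivity (f (a ^+ 2 + 3 * b ^+ 2 - (c ^+ 2 + 3 * d ^+ 2))
      + f (2 * a * b - 2 * c * d) * h); first by ring: hE.
  by rewrite E1 E2 !rmorph0 mul0r addr0.
rewrite mulf_eq0 => /orP[]/eqP/(sqrt3_free hE)[Eac Ebd].
  have [ca db] : c = a /\ d = b by split; lra.
  subst c d; have a0 : a = 0 by apply/eqP; rewrite -sqrf_eq0; apply/eqP; nra.
  by suff /eqP : 0 = 1 :> rat by []; subst a; lra.
have [ca db] : c = - a /\ d = - b by split; lra.
subst c d; have a0 : a = 0 by apply/eqP; rewrite -sqrf_eq0; apply/eqP; nra.
suff /eqP : 0 = 1 :> rat by []; subst a; lra.
Qed.

(** For s = A + i B, the imaginary part gives A B = 0. If A = 0, the rational part of -B^2 is not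
    positive, hence not 3. If B = 0, the norm of A would be a rational number with square 9 - 12 =
    -3. *)
Lemma sqr_neq_3B (s : K) : s ^+ 2 <> 3 - 2 * h.
Proof.
have [f [a [b [c [d sE]]]]] := sqrt3_i_span s => E.
have [E1 E2 E3 E4] : [/\ a ^+ 2 + 3 * b ^+ 2 - (c ^+ 2 + 3 * d ^+ 2) - 3 = 0,
     2 * a * b - 2 * c * d + 2 = 0,
     2 * (a * c + 3 * b * d) = 0 & 2 * (a * d + b * c) = 0].
  apply: (sqrt3_i_free hE iE (f := f)).
  rewrite -(subrr (s ^+ 2)) {2}E sE.
  by ring: hE iE.
have /eqP : (f a + f b * h) * (f c + f d * h) = 0.
  transitivity (f (2 * (a * c + 3 * b * d)) / 2 + f (2 * (a * d + b * c)) / 2 * h).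
    by field: hE.
  by rewrite E3 E4 !rmorph0 !mul0r addr0.
rewrite mulf_eq0 => /orP[]/eqP/(sqrt3_free hE)[a0 b0].
  suff /eqP : 0 = 1 :> rat by []; subst a b; nra.
subst c d; have := sqr_ge0 (a ^+ 2 - 3 * b ^+ 2).
have -> : (a ^+ 2 - 3 * b ^+ 2) ^+ 2
    = (a ^+ 2 + 3 * b ^+ 2) ^+ 2 - 3 * (2 * a * b) ^+ 2 by ring.
have [-> ->] : a ^+ 2 + 3 * b ^+ 2 = 3 /\ 2 * a * b = - 2 by split; lra.
by rewrite (_ : _ - _ = - 3%:R) ?oppr_ge0 ?lern0 //; ring.
Qed.

End Biquadratic.

End QuarticField.

(** * Doubling on the modular curve *)

Section ModularCurve.
Variable F : fieldType.
Implicit Types P : F * F.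

Definition on_X P : Prop := P.2 ^+ 2 = P.1 ^+ 3 - P.1 ^+ 2 + P.1.

(** The excluded x are, in this order, those where t is infinite, t = 0 or -2, t = -1, t = -1/2, and
    t = 1. *)
Definition noncusp (x : F) : bool :=
  [&& x != 0, x ^+ 2 != 1, x ^+ 2 + 1 != 0, x ^+ 2 - x + 1 != 0
    & x ^+ 2 - 4 * x + 1 != 0].

(** Since (0, 0) is a 2-torsion point, the x-coordinate of a double is a square r^2; the descent
    below works with r. *)
Definition doubling P : F * F :=
  let: (x, y) := P in
  (((x ^+ 2 - 1) / (2 * y)) ^+ 2,
   (x ^+ 2 - 1) * (x ^+ 4 - 2 * x ^+ 3 + 6 * x ^+ 2 - 2 * x + 1) / (8 * y ^+ 3)).

Hypothesis two0 : 2 != 0 :> F.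

Lemma noncusp_y_neq0 P : on_X P -> noncusp P.1 -> P.2 != 0.
Proof.
move=> XP /and5P[x0 _ _ q0 _]; rewrite -sqrf_eq0 XP.
have -> : P.1 ^+ 3 - P.1 ^+ 2 + P.1 = P.1 * (P.1 ^+ 2 - P.1 + 1) by ring.
by rewrite mulf_neq0.
Qed.

Lemma double_on_X P : on_X P -> P.2 != 0 -> on_X (doubling P).
Proof.
case: P => x y; rewrite /on_X /= => XP y0.
have f0 : 2 * y != 0 by rewrite mulf_neq0.
have -> : 8 * y ^+ 3 = (2 * y) ^+ 3 by ring.
set c := x ^+ 2 - 1; set d := _ + 1; set f := 2 * y in f0 *.
have -> : (c * d / f ^+ 3) ^+ 2 = c ^+ 2 * d ^+ 2 / f ^+ 6 by field.
have -> : ((c / f) ^+ 2) ^+ 3 - ((c / f) ^+ 2) ^+ 2 + (c / f) ^+ 2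
  = c ^+ 2 * (c ^+ 4 - c ^+ 2 * f ^+ 2 + f ^+ 4) / f ^+ 6 by field.
have f2 : f ^+ 2 = 4 * (x ^+ 3 - x ^+ 2 + x) by rewrite /f exprMn XP; ring.
have -> : f ^+ 4 = (f ^+ 2) ^+ 2 by ring.
by congr (_ / _); rewrite f2 /c /d; ring.
Qed.

End ModularCurve.

(** * Halves of cusps are cusps over a quartic field *)

Section Descent.
Variable K : fieldExtType rat.
Hypothesis dimK : \dim {:K} = 4%N.

Let two0 : 2 != 0 :> K. Proof. by rewrite fieldExt_rat_natr_eq0. Qed.

(* With w = x + 1/x, the x-coordinates of the halves of (e, _) are the roots of
   (w - 2e)^2 = 4(e^2 - e + 1). *)
Lemma half_sum (x y r v : K) : on_X (x, y) -> noncusp x ->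
  (x ^+ 2 - 1) / (2 * y) = r -> r ^+ 4 - r ^+ 2 + 1 = v ^+ 2 ->
  exists2 v', v' = v \/ v' = - v & (y / x) ^+ 2 = 2 * r ^+ 2 + 2 * v' - 1.
Proof.
move=> XP nx rE vE; have y0 : y != 0 := noncusp_y_neq0 XP nx.
have [x0 _ _ _ _] := and5P nx; rewrite /on_X /= in XP.
set w := x + x^-1.
have yx : (y / x) ^+ 2 = w - 1 by rewrite expr_div_n XP /w; field.
have : (w - 2 * r ^+ 2 - 2 * v) * (w - 2 * r ^+ 2 + 2 * v) = 0.
  transitivity ((w - 2 * r ^+ 2) ^+ 2 - 4 * v ^+ 2); first by ring.
  have r2 : 4 * r ^+ 2 * (w - 1) = w ^+ 2 - 4.
    rewrite -yx -rE /w; field; first by rewrite x0 y0 two0.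
  have -> : (w - 2 * r ^+ 2) ^+ 2
    = w ^+ 2 - 4 - 4 * r ^+ 2 * (w - 1) + 4 * (r ^+ 4 - r ^+ 2 + 1) by ring.
  by rewrite r2 vE; ring.
move=> /eqP; rewrite mulf_eq0 => /orP[]/eqP wE.
  exists v; first by left.
  by rewrite yx; congr (_ - 1); apply/subr0_eq; rewrite -wE; ring.
exists (- v); first by right.
by rewrite yx; congr (_ - 1); apply/subr0_eq; rewrite -wE; ring.
Qed.

Section DyadicNonsquares.
Variable O : set K.
Hypotheses (valO : is_valuation_ring O) (O2 : O 2) (O2V : ~ O 2^-1).

Let subO : is_subring O. Proof. by case: valO. Qed.

(** Here (b / r^2)^2 would be 1 plus an element of level 4 + 1 = 5, which is odd and below 8. *)
Let level1_not_square (r b c : K) : vunit O r -> level O 1 (1 + r) ->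
  b ^+ 2 = r ^+ 4 * (1 + 2 * (1 + r) * c) -> ~ vunit O c.
Proof.
move=> ur l1 bE uc; have r0 : r != 0 by case: ur.
have /eqP[] : (b / r ^+ 2) ^+ 2 != 1 + 2 * (1 + r) * c; last first.
  by rewrite expr_div_n bE; field.
apply: (@not_square_level _ _ valO O2 O2V two0 _ _ 2) => //.
  exact: level_exists l1.
rewrite -[_%:Z]addr0; apply: (levelM valO) => //; last exact: level_unit.
rewrite (_ : Posz _ = 4 + 1) //; apply: (levelM valO) => //; exact: level2.
Qed.

Let level1_1D (r : K) : vunit O r ->
  (exists2 d, vunit O d & (1 + r) ^+ 4 = 2 * d) -> level O 1 (1 + r).
Proof.
by move=> ur [d ud]; rewrite /level -exprnP expr1 => ->; rewrite mulrAC divff ?mul1r.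
Qed.

(** Here r is a primitive 8th root of unity. The equation r^4 = -1 turns (1 + r)^4 into twice a unit
    and the right-hand side into r^4 (1 - 2 (1 + r) r^2). *)
Lemma not_square_zeta8 (r b : K) :
  r ^+ 4 = -1 -> b ^+ 2 <> 2 * r ^+ 2 + 2 * r ^+ 3 - 1.
Proof.
move=> r4 bE; have ur : vunit O r.
  by apply: (@vunit_root _ _ valO r 3); rewrite r4; apply: (vunitN valO); exact: (vunit1 valO).
have Or : O r by case: ur.
have l1 : level O 1 (1 + r).
  apply: level1_1D => //; exists (3 * r ^+ 2 + 2 * (r + r ^+ 3)); last by ring: r4.
  apply: (vunitDm valO) => //.
    by apply: (vunitM valO);
      [exact: (@vunit_odd _ _ valO O2 O2V two0 3 isT)|exact: (vunitX valO)].
  rewrite mulrC; apply: (vmaxMl valO) => //; last exact: vmax2.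
  by apply: subringD => //; apply: subringX.
apply: (level1_not_square (b := b) (c := - r ^+ 2) ur l1); first by rewrite bE; ring: r4.
by apply: (vunitN valO); apply: (vunitX valO).
Qed.

(** The roots r generate Q(sqrt 2, sqrt 3), and 1 + r again has a fourth power equal to twice a
    unit. *)
Lemma not_square_sqrt2_sqrt3 (r b : K) : r ^+ 4 = 4 * r ^+ 2 - 1 ->
  b ^+ 2 <> 2 * r ^+ 2 + 2 * (r ^+ 3 - 2 * r) - 1.
Proof.
move=> r4 bE.
have unit_of (q : K) : O q -> q ^+ 4 = 4 * q ^+ 2 - 1 -> vunit O q.
  move=> Oq q4; have q1 : q * (4 * q - q ^+ 3) = 1 by ring: q4.
  have q0 : q != 0 by apply: contra_eq_neq q1 => ->; rewrite mul0r eq_sym oner_eq0.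
  split=> //; rewrite -[q^-1]mulr1 -q1 mulKf //.
  apply: subringB => //; last exact: subringX.
  by apply: subringM => //; exact: (subring_nat subO 4).
have r0 : r != 0.
  by apply: contra_eq_neq r4 => ->; rewrite !expr0n mulr0 sub0r eq_sym oppr_eq0 oner_eq0.
(* The equation is palindromic, so 1/r satisfies it too, and one of r, 1/r is in O. *)
have ur : vunit O r.
  have [_ /(_ r)[Or|OrV]] := valO; first exact: unit_of.
  rewrite -[r]invrK; apply: vunitV; apply: unit_of => //.
  have -> : 4 * r^-1 ^+ 2 - 1 = (4 * r ^+ 2 - r ^+ 4) / r ^+ 4 by field.
  by rewrite {1}r4 opprB addrC subrK exprVn mul1r.
have Or : O r by case: ur.
have l1 : level O 1 (1 + r).
  apply: level1_1D => //; exists (5 * r ^+ 2 + 2 * (r + r ^+ 3)); last by ring: r4.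
  apply: (vunitDm valO) => //.
    by apply: (vunitM valO);
      [exact: (@vunit_odd _ _ valO O2 O2V two0 5 isT)|exact: (vunitX valO)].
  rewrite mulrC; apply: (vmaxMl valO) => //; last exact: vmax2.
  by apply: subringD => //; apply: subringX.
apply: (level1_not_square (b := b) (c := (r - 2) / r ^+ 3) ur l1).
  rewrite bE; have -> : r ^+ 4 * (1 + 2 * (1 + r) * ((r - 2) / r ^+ 3))
    = r ^+ 4 + 2 * (1 + r) * (r - 2) * r by field.
  by ring: r4.
apply: (vunitM valO); last by apply: vunitV; apply: (vunitX valO).
by apply: (vunitDm valO) => //; apply: (vmaxN valO); exact: vmax2.
Qed.

End DyadicNonsquares.

(** With x(2P) = r^2, each cuspidal value is excluded in turn. For r^2 = 1 the point P is itself a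
    cusp, because (x^2 - 1)^2 - 4 y^2 = (x^2 + 1) (x^2 - 4 x + 1). In the other cases K contains a
    square that the preceding lemmas forbid. *)
Lemma double_noncusp (P : K * K) : on_X P -> noncusp P.1 -> noncusp (doubling P).1.
Proof.
case: P => x y XP nx; have y0 : y != 0 := noncusp_y_neq0 XP nx.
have [x0 x1 xi xo xh] := and5P nx; rewrite /= in x0 x1 xi xo xh *.
have xy : y ^+ 2 = x ^+ 3 - x ^+ 2 + x by [].
set r := _ / _; have rE : r * (2 * y) = x ^+ 2 - 1 by rewrite divfK // mulf_neq0.
have r0 : r != 0 by rewrite mulf_neq0 ?invr_eq0 ?mulf_neq0 // subr_eq0.
have r2 : 4 * r ^+ 2 * y ^+ 2 = (x ^+ 2 - 1) ^+ 2 by rewrite -rE; ring.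
have [O [valO O2 O2V]] := exists_2adic_ring K.
apply/and5P; split.
- by rewrite expf_neq0.
- apply/eqP => D2; have /eqP : (r ^+ 2 - 1) * (r ^+ 2 + 1) = 0.
    by transitivity ((r ^+ 2) ^+ 2 - 1); [ring|rewrite D2 subrr].
  rewrite mulf_eq0 => /orP[/eqP/subr0_eq rr|/eqP rr].
    have /eqP : (x ^+ 2 + 1) * (x ^+ 2 - 4 * x + 1) = 0.
      transitivity ((x ^+ 2 - 1) ^+ 2 - 4 * y ^+ 2); first by rewrite xy; ring.
      by rewrite -r2 rr mulr1 subrr.
    by rewrite mulf_eq0 (negbTE xi) (negbTE xh).
  have r2N : r ^+ 2 = -1 by apply/eqP; rewrite -addr_eq0 rr.
  (* With w = x + 1/x the equation r^2 = -1 reads (w + 2)^2 = 12, so h^2 = 3, while ((x - 1/x) /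
     2)^2 = (w^2 - 4) / 4 = 3 - 2 h. *)
  pose h := (x + x^-1 + 2) / 2.
  have : (x ^+ 2 - 1) ^+ 2 + 4 * (x ^+ 3 - x ^+ 2 + x) = 0 by rewrite -xy -r2 r2N; ring.
  move=> E; apply: (@sqr_neq_3B _ dimK r h r2N _ ((x - x^-1) / 2)).
    apply/eqP; rewrite -subr_eq0 /h; apply/eqP.
    transitivity (((x ^+ 2 - 1) ^+ 2 + 4 * (x ^+ 3 - x ^+ 2 + x)) / (4 * x ^+ 2));
      last by rewrite E mul0r.
    by field; rewrite x0 !fieldExt_rat_natr_eq0.
  apply/eqP; rewrite -subr_eq0 /h; apply/eqP.
  transitivity (((x ^+ 2 - 1) ^+ 2 + 4 * (x ^+ 3 - x ^+ 2 + x)) / (4 * x ^+ 2));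
      last by rewrite E mul0r.
  by field; rewrite x0 !fieldExt_rat_natr_eq0.
- apply/eqP => rr; have r4 : r ^+ 4 = -1 by apply/eqP; rewrite -addr_eq0 (exprM _ 2 2) rr.
  have vE : r ^+ 4 - r ^+ 2 + 1 = (r ^+ 3) ^+ 2 by ring: r4.
  have [v [->|->]] := half_sum XP nx erefl vE.
    exact: (not_square_zeta8 valO O2 O2V).
  (* The root v is odd in r, so the other sign is the first case for -r. *)
  have -> : 2 * r ^+ 2 + 2 * - r ^+ 3 - 1 = 2 * (- r) ^+ 2 + 2 * (- r) ^+ 3 - 1 by ring.
  by apply: (not_square_zeta8 valO O2 O2V) => //; rewrite -r4; ring.
(* Here r is a primitive 12th root of unity, and s^2 is the difference x(2P) - x(T) for the
   2-torsion point T with x(T) = 1 - r^2. It equals 2 r^2 - 1, a square root of -3. *)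
- apply/eqP => rr; pose i := r ^+ 3; pose s := (x ^+ 2 - 2 * (1 - r ^+ 2) * x + 1) / (2 * y).
  have r4 : r ^+ 4 = r ^+ 2 - 1
    by transitivity ((r ^+ 2) ^+ 2 - r ^+ 2 + 1 + r ^+ 2 - 1); [ring|rewrite rr add0r].
  have iE : i ^+ 2 = -1 by rewrite /i; ring: r4.
  have s2 : s ^+ 2 = 2 * r ^+ 2 - 1.
    have y2 : (2 * y) ^+ 2 != 0 by rewrite expf_neq0 // mulf_neq0.
    apply: (mulIf y2); rewrite expr_div_n divfK //.
    have -> : (x ^+ 2 - 2 * (1 - r ^+ 2) * x + 1) ^+ 2
      = (x ^+ 2 - 1) ^+ 2 - 4 * (1 - r ^+ 2) * (x ^+ 3 - x ^+ 2 + x) by ring: r4.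
    by rewrite -xy -r2; ring.
  apply: (@sqr_neq_iM _ dimK i (- i * s ^+ 2) iE _ s); last by ring: iE.
  by rewrite s2; ring: iE r4.
- apply/eqP => rr; have r4 : r ^+ 4 = 4 * r ^+ 2 - 1.
    by transitivity ((r ^+ 2) ^+ 2 - 4 * r ^+ 2 + 1 + 4 * r ^+ 2 - 1); [ring|rewrite rr add0r].
  have vE : r ^+ 4 - r ^+ 2 + 1 = (r ^+ 3 - 2 * r) ^+ 2 by ring: r4.
  have [v [->|->]] := half_sum XP nx erefl vE.
    exact: (not_square_sqrt2_sqrt3 valO O2 O2V).
  have -> : 2 * r ^+ 2 + 2 * - (r ^+ 3 - 2 * r) - 1
    = 2 * (- r) ^+ 2 + 2 * ((- r) ^+ 3 - 2 * (- r)) - 1 by ring.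
  by apply: (not_square_sqrt2_sqrt3 valO O2 O2V) => //; ring: r4.
Qed.

End Descent.

Definition t_of (F : fieldType) (x : F) : F := (x - 1) ^+ 2 / (2 * x).

(** * Valuations along the doubling orbit *)

Section Orbit.
Variable K : fieldExtType rat.
Hypothesis dimK : \dim {:K} = 4%N.

Let two0 : 2 != 0 :> K. Proof. by rewrite fieldExt_rat_natr_eq0. Qed.

Variable O : set K.
Hypotheses (valO : is_valuation_ring O) (O2 : O 2) (O2V : ~ O 2^-1).

Let subO : is_subring O. Proof. by case: valO. Qed.
Let max2 : vmax O 2. Proof. exact: vmax2. Qed.

Lemma doubleE (P : K * K) : on_X P -> noncusp P.1 ->
  4 * (P.1 * (P.1 ^+ 2 - P.1 + 1)) * (doubling P).1 = (P.1 ^+ 2 - 1) ^+ 2.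
Proof.
case: P => x y XP nx; have /= y0 := noncusp_y_neq0 XP nx.
rewrite /on_X /= in XP *.
have -> : x * (x ^+ 2 - x + 1) = y ^+ 2 by rewrite XP; ring.
by field; rewrite y0.
Qed.

(** The duplication formula makes (x^2 - 1)^2 divisible by 4, and (x - 1)^4 differs from it by 4 x
    (x - 1)^2. *)
Lemma double_integral (P : K * K) : on_X P -> noncusp P.1 ->
  O P.1 -> O (doubling P).1 -> vmax O (P.1 - 1).
Proof.
move=> XP nx Ox Od; have E := doubleE XP nx.
move: (P.1) ((doubling P).1) Ox Od E => x d Ox Od E.
apply: (@vmax_root _ _ valO _ 3).
have -> : (x - 1) ^+ 4 = (2 * (x * (x ^+ 2 - x + 1) * d - x * (x - 1) ^+ 2)) * 2.
  transitivity ((x ^+ 2 - 1) ^+ 2 - 4 * x * (x - 1) ^+ 2); first by ring.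
  by rewrite -E; ring.
have O1 := subring1 subO.
apply: (vmaxMl valO) => //.
by do ![apply: subringM | apply: subringB | apply: subringD | apply: subringX] => //.
Qed.

(** With u = x - 1, the duplication formula makes (u (u + 2) / 2)^2 a unit. Then u cannot be
    divisible by 2, so u + 2 is u times a unit. *)
Lemma double_unit (P : K * K) : on_X P -> noncusp P.1 ->
  vmax O (P.1 - 1) -> vmax O ((doubling P).1 - 1) -> vunit O ((P.1 - 1) ^+ 2 / 2).
Proof.
move=> XP nx; have E := doubleE XP nx.
move: (P.1) ((doubling P).1) E => x d E mu md.
have unit1D z : vmax O (z - 1) -> vunit O z.
  by move=> mz; rewrite -[z](subrK 1) addrC; apply: (vunitDm valO) => //; exact: vunit1.
have ux := unit1D _ mu; have ud := unit1D _ md.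
set u := x - 1 in mu *; have xE : x = u + 1 by rewrite subrK.
have Ou : O u by case: mu.
have uq : vunit O (x ^+ 2 - x + 1).
  apply: unit1D; have -> : x ^+ 2 - x + 1 - 1 = x * u by rewrite /u; ring.
  by apply: (vmaxMl valO) => //; case: ux.
have uv : vunit O (u * (u + 2) / 2).
  apply: (@vunit_root _ _ valO _ 1).
  have -> : (u * (u + 2) / 2) ^+ 2 = x * (x ^+ 2 - x + 1) * d.
    transitivity ((x ^+ 2 - 1) ^+ 2 / 4).
      by rewrite xE; field; rewrite !fieldExt_rat_natr_eq0.
    by rewrite -E; field; rewrite !fieldExt_rat_natr_eq0.
  by do !apply: (vunitM valO).
have [u2|u2] := pselect (O (u / 2)).
  suff : vmax O (u * (u + 2) / 2) by case.
  have -> : u * (u + 2) / 2 = (u / 2) * (u / 2 + 1) * 2 by field.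
  by apply: (vmaxMl valO) => //; apply: subringM => //; apply: subringD => //; exact: subring1.
have m2 := vmax_inv valO u2; rewrite invf_div in m2.
have u0 : u != 0 by apply/eqP => u0; apply: u2; rewrite u0 mul0r; exact: subring0.
have u12 : vunit O (1 + 2 / u) by apply: (vunitDm valO) => //; exact: vunit1.
have -> : u ^+ 2 / 2 = u * (u + 2) / 2 * (1 + 2 / u)^-1.
  have -> : u * (u + 2) / 2 = u ^+ 2 / 2 * (1 + 2 / u) by field; rewrite u0 ?fieldExt_rat_natr_eq0.
  by rewrite mulfK //; case: u12.
by apply: (vunitM valO) => //; exact: vunitV.
Qed.

(* With u = x - 1 of valuation 1/2, p = (u^2 + 2 u + 2) / 2 has valuation 1/4, so that
   y^2 = 1 + 2 p u is not a square. *)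
Lemma double_ramified (P : K * K) : on_X P -> noncusp P.1 ->
  vmax O (P.1 - 1) ->
  vunit O ((P.1 - 1) ^+ 2 / 2) -> vunit O (((doubling P).1 - 1) ^+ 2 / 2) -> False.
Proof.
move=> XP nx; have E := doubleE XP nx; rewrite /on_X in XP.
move: (P.1) (P.2) ((doubling P).1) XP E => x y d XP E mu.
set u := x - 1 in mu *; set u' := d - 1 => uu uu'.
have xE : x = u + 1 by rewrite subrK.
have dE : d = u' + 1 by rewrite subrK.
have Ou : O u by case: mu.
have O1 := subring1 subO.
pose p := u ^+ 2 / 2 + u + 1.
have Op : O p by case: uu => _ ? _; apply: subringD => //; apply: subringD.
have unit1D z : vmax O (z - 1) -> vunit O z.
  by move=> mz; rewrite -[z](subrK 1) addrC; apply: (vunitDm valO) => //; exact: vunit1.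
have uq : vunit O (x * (x ^+ 2 - x + 1)).
  apply: (vunitM valO); first exact: unit1D.
  apply: unit1D; have -> : x ^+ 2 - x + 1 - 1 = x * u by rewrite /u; ring.
  by apply: (vmaxMl valO) => //; rewrite xE; apply: subringD.
(* The factors are (x^2 + 1) / 2 and (x^2 - 4 x + 1) / 2, with product y^2 (x(2P) - 1) of valuation
   1/2. Once p is known not to be divisible by 2, both factors have the valuation of p. *)
have pE : p * (p - 2 * (1 + u)) = u' * (x * (x ^+ 2 - x + 1)).
  have u'E : 4 * (x * (x ^+ 2 - x + 1)) * u' = (x ^+ 2 - 1) ^+ 2 - 4 * (x * (x ^+ 2 - x + 1)).
    by rewrite -E /u'; ring.
  have four0 : 4 != 0 :> K by rewrite fieldExt_rat_natr_eq0.
  apply: (mulfI four0); transitivity ((x ^+ 2 - 1) ^+ 2 - 4 * (x * (x ^+ 2 - x + 1))).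
    by rewrite /p xE; field.
  by rewrite -u'E; ring.
have up : vunit O ((p * (p - 2 * (1 + u))) ^+ 2 / 2).
  rewrite pE exprMn mulrAC; apply: (vunitM valO) => //; exact: vunitX.
have p2 : ~ O (p / 2).
  move=> p2; suff : vmax O ((p * (p - 2 * (1 + u))) ^+ 2 / 2) by case.
  have -> : (p * (p - 2 * (1 + u))) ^+ 2 / 2 = (4 * ((p / 2) * (p / 2 - (1 + u))) ^+ 2) * 2.
    by field.
  apply: (vmaxMl valO) => //; apply: subringM => //; first exact: (subring_nat subO 4).
  apply: subringX => //; apply: subringM => //; apply: subringB => //.
  exact: subringD.
have m2 := vmax_inv valO p2; rewrite invf_div in m2.
have p0 : p != 0 by apply/eqP => p0; apply: p2; rewrite p0 mul0r; exact: subring0.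
pose w := 1 - 2 / p * (1 + u).
have uw : vunit O w.
  apply: (vunitDm valO); first exact: vunit1.
  by apply: (vmaxN valO); rewrite mulrC; apply: (vmaxMl valO) => //; apply: subringD.
have l1 : level O 1 p.
  rewrite /level -exprnP expr1.
  have [w0 _ _] := uw.
  have -> : p ^+ 4 / 2 = (p * (p - 2 * (1 + u))) ^+ 2 / 2 * (w ^+ 2)^-1.
    have -> : p * (p - 2 * (1 + u)) = p ^+ 2 * w by rewrite /w; field.
    by field; rewrite w0.
  by apply: (vunitM valO) => //; apply: vunitV; apply: vunitX.
have l2 : level O 2 u.
  rewrite /level; have -> : (2 : K) ^ (2 : int) = 2 ^+ 2 by [].
  by rewrite (exprM u 2 2) -expr_div_n; exact: vunitX.
have lc : level O 7 (2 * p * u).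
  rewrite (_ : 7 = 4 + 1 + 2) //; do 2!apply: (levelM valO) => //; exact: level2.
have /eqP[] := @not_square_level _ _ valO O2 O2V two0 y (2 * p * u) 3
  (level_exists dimK valO O2 O2V l1) isT lc.
by rewrite XP xE /p; field.
Qed.

(** With z = 1/x in the maximal ideal, duplication gives 4 x(2P) / x = (1 - z^2)^2 / (1 - z + z^2),
    a unit. *)
Lemma double_escapes (P : K * K) : on_X P -> noncusp P.1 -> ~ O P.1 ->
  vunit O ((doubling P).1 * 4 / P.1) /\ ~ O (doubling P).1.
Proof.
move=> XP nx nO; have E := doubleE XP nx.
have /and5P[x0 x1 _ q0 _] := nx.
move: (P.1) ((doubling P).1) nO E x0 x1 q0 => x d nO E x0 x1 q0.
have mz := vmax_inv valO nO; have [Oz _] := mz.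
have O1 := subring1 subO; have u1 := vunit1 valO.
have ud : vunit O (d * 4 / x).
  have -> : d * 4 / x = (1 - x^-1 * x^-1) ^+ 2 * (1 + x^-1 * (x^-1 - 1))^-1.
    have -> : (1 - x^-1 * x^-1) ^+ 2 = (x ^+ 2 - 1) ^+ 2 / x ^+ 4 by field.
    rewrite -E; field; rewrite x0 /=.
    by rewrite (_ : _ + _ = x ^+ 2 - x + 1) ?q0 //; ring.
  apply: (vunitM valO).
    apply: (vunitX valO); apply: (vunitDm valO) => //; apply: (vmaxN valO).
    exact: (vmaxMl valO).
  apply: vunitV; apply: (vunitDm valO) => //; rewrite mulrC.
  by apply: (vmaxMl valO) => //; apply: subringB.
split=> // Od; apply: nO; have [_ _ udV] := ud.
have d0 : d != 0.
  apply: contraNneq x1 => d0; move: E; rewrite d0 mulr0 => /esym/eqP.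
  by rewrite sqrf_eq0 subr_eq0.
have -> : x = (d * 4 / x)^-1 * d * 4.
  by field; rewrite x0 d0 fieldExt_rat_natr_eq0.
apply: subringM => //; last exact: (subring_nat subO 4).
exact: subringM.
Qed.

Lemma orbit_on_X (P : K * K) n : on_X P -> noncusp P.1 ->
  on_X (iter n (@doubling K) P) /\ noncusp (iter n (@doubling K) P).1.
Proof.
move=> XP nP; elim: n => //= n [XQ nQ]; split.
  by apply: double_on_X => //; exact: noncusp_y_neq0.
exact: double_noncusp.
Qed.

Lemma orbit_nonintegral (P : K * K) : on_X P -> noncusp P.1 ->
  exists n, ~ O (iter n (@doubling K) P).1.
Proof.
move=> XP nP; apply: contrapT => Onot.
have Oall n : O (iter n (@doubling K) P).1 by apply: contra_notP Onot; exists n.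
have orb n := orbit_on_X n XP nP.
have mall n : vmax O ((iter n (@doubling K) P).1 - 1).
  by have [X N] := orb n; apply: double_integral => //; exact: (Oall n.+1).
have uall n : vunit O (((iter n (@doubling K) P).1 - 1) ^+ 2 / 2).
  by have [X N] := orb n; apply: double_unit => //; exact: (mall n.+1).
exact: (double_ramified XP nP (mall 0) (uall 0) (uall 1)).
Qed.

Lemma t_of_eq (x z : K) : x != 0 -> z != 0 -> t_of x = t_of z -> x = z \/ x = z^-1.
Proof.
move=> x0 z0 E; have /eqP : (x - z) * (x * z - 1) = 0.
  transitivity ((t_of x - t_of z) * (2 * x * z)); last by rewrite E subrr mul0r.
  by rewrite /t_of; field; rewrite x0 z0 fieldExt_rat_natr_eq0.
rewrite mulf_eq0 !subr_eq0 => /orP[/eqP|/eqP xz]; first by left.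
by right; rewrite -[x](mulfK z0) xz mul1r.
Qed.

(** Equal values of t come from equal or inverse x. Inverse ones cannot both lie outside O, and
    equal ones at distinct times would make a positive power of 4 a unit. *)
Lemma orbit_t_inj (P : K * K) : on_X P -> noncusp P.1 -> ~ O P.1 ->
  injective (fun n => t_of (iter n (@doubling K) P).1).
Proof.
move=> XP nP nO.
have orb n := orbit_on_X n XP nP.
pose X n := (iter n (@doubling K) P).1.
have X0 n : X n != 0 by have [_ /and5P[]] := orb n.
have nX n : ~ O (X n).
  by elim: n => // n IH; have [XQ nQ] := orb n; have [] := double_escapes XQ nQ IH.
have uX m k : vunit O (X (m + k)%N * 4 ^+ k / X m).
  elim: k => [|k IH]; first by rewrite addn0 expr0 mulr1 divff //; exact: vunit1.
  have [XQ nQ] := orb (m + k)%N; have [ud _] := double_escapes XQ nQ (nX _).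
  rewrite addnS; have -> : X (m + k).+1 * 4 ^+ k.+1 / X m
    = X (m + k).+1 * 4 / X (m + k)%N * (X (m + k)%N * 4 ^+ k / X m).
    by rewrite exprS; field; rewrite !X0.
  exact: (vunitM valO).
move=> m n; wlog le_mn : m n / (m <= n)%N.
  by move=> W; have [/W|/ltnW/W + /esym] := leqP m n; [exact|move=> /[apply]].
rewrite -/(X m) -/(X n) -(subnKC le_mn); move: (n - m)%N => k {le_mn n} E.
have [XE|XE] := t_of_eq (X0 _) (X0 _) E; last first.
  by case: (nX m); rewrite XE; case: (vmax_inv valO (nX (m + k)%N)).
case: k {E} XE => [|k] XE; first by rewrite addn0.
have := uX m k.+1; rewrite -XE mulrAC divff // mul1r => /(vunit_root valO).
have -> : 4 = 2 ^+ 2 :> K by ring.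
by move=> /(vunit_root valO)[_ _ /O2V].
Qed.

End Orbit.

Lemma infinitely_many_parameters (K : fieldExtType rat) (P : K * K) :
  \dim {:K} = 4%N -> on_X P -> noncusp P.1 ->
  exists Q : nat -> K * K, (forall n, on_X (Q n) /\ noncusp (Q n).1)
    /\ injective (fun n => t_of (Q n).1).
Proof.
move=> dimK XP nP; have [O [valO O2 O2V]] := exists_2adic_ring K.
have [n nO] := orbit_nonintegral dimK valO O2 O2V XP nP.
have [XQ nQ] := orbit_on_X dimK n XP nP.
exists (fun k => iter k (@doubling K) (iter n (@doubling K) P)).
split=> [k|]; first exact: orbit_on_X.
exact: (orbit_t_inj dimK valO O2V XQ nQ nO).
Qed.

(** * From a torsion subgroup to a point of the modular curve *)

Section ChordTangent.
Variables (F : fieldType) (W : weierstrass F).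
Hypothesis two0 : 2 != 0 :> F.

(** Completing the square gives Y^2 = [cubic x], where negation of points is Y to -Y. *)
Definition cubic (x : F) : F := x ^+ 3 + b2 W / 4 * x ^+ 2 + b4 W / 2 * x + b6 W / 4.

Definition completed_y (x y : F) : F := y + (a1 W * x + a3 W) / 2.

Let four0 : 4 != 0 :> F.
Proof. by have -> : 4 = 2 ^+ 2 :> F; [ring|exact: expf_neq0]. Qed.

Lemma cubic_on_curve x y : on_curve W (Affine x y) -> cubic x = completed_y x y ^+ 2.
Proof.
move=> /eqP E; rewrite /cubic /completed_y /b2 /b4 /b6.
transitivity (x ^+ 3 + a2 W * x ^+ 2 + a4 W * x + a6 W + ((a1 W * x + a3 W) / 2) ^+ 2).
  by field; rewrite ?four0 ?two0.
by rewrite -E; field.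
Qed.

(** The formula for x3 cancels the quadratic term of the difference [h] of the two sides, which is
    then linear. It vanishes at x1 and x2, or doubly at x1 for a tangent. *)
Lemma add_point_line x1 y1 x2 y2 x3 y3 :
  on_curve W (Affine x1 y1) -> on_curve W (Affine x2 y2) ->
  add_point W (Affine x1 y1) (Affine x2 y2) = Affine x3 y3 ->
  exists l m, [/\ completed_y x1 y1 = l * x1 + m, completed_y x2 y2 = l * x2 + m,
    completed_y x3 y3 = - (l * x3 + m)
    & forall x, cubic x = (l * x + m) ^+ 2 + (x - x1) * (x - x2) * (x - x3)].
Proof.
move=> C1 C2 /=; case: ifP => // /negbT nopp [].
set l0 := slope _ _ _ _ _ => x3E y3E.
have g1 := cubic_on_curve C1; have g2 := cubic_on_curve C2.
pose l := l0 + a1 W / 2; pose m := completed_y x1 y1 - l * x1.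
have E1 : completed_y x1 y1 = l * x1 + m by rewrite /m addrC subrK.
have x3l : x3 = l ^+ 2 - b2 W / 4 - x1 - x2 by rewrite -x3E /l /b2; field; rewrite ?four0 ?two0.
pose h x := cubic x - ((l * x + m) ^+ 2 + (x - x1) * (x - x2) * (x - x3)).
have h1 : h x1 = 0 by rewrite /h -E1 g1; ring.
have E3 : completed_y x3 y3 = - (l * x3 + m).
  by rewrite -y3E x3E /m /l /completed_y; field.
suff [E2 hE] : completed_y x2 y2 = l * x2 + m /\ forall x, h x = 0.
  by exists l, m; split=> // x; apply/subr0_eq/hE.
have [ex|nx] := eqVneq x1 x2.
  subst x2; rewrite eqxx /= in nopp.
  have ey : y2 = y1.
    have /eqP : (y2 - y1) * (y2 - (- y1 - a1 W * x1 - a3 W)) = 0.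
      transitivity (completed_y x1 y2 ^+ 2 - completed_y x1 y1 ^+ 2);
        last by rewrite -g1 -g2 subrr.
      by rewrite /completed_y; field.
    by rewrite mulf_eq0 [X in _ || X]subr_eq0 (negbTE nopp) orbF => /eqP/subr0_eq.
  subst y2; split=> // x.
  have d0 : 2 * y1 + a1 W * x1 + a3 W != 0.
    by apply: contraNneq nopp => d; apply/eqP/subr0_eq; rewrite -d; ring.
  have lE : l0 * (2 * y1 + a1 W * x1 + a3 W)
      = 3 * x1 ^+ 2 + 2 * a2 W * x1 + a4 W - a1 W * y1.
    by rewrite /l0 /slope eqxx divfK.
  have tangent : 3 * x1 ^+ 2 + b2 W / 2 * x1 + b4 W / 2 - 2 * l * (l * x1 + m) = 0.
    rewrite -E1; transitivity (3 * x1 ^+ 2 + 2 * a2 W * x1 + a4 W - a1 W * y1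
        - l0 * (2 * y1 + a1 W * x1 + a3 W)).
      by rewrite /b2 /b4 /l /completed_y; field; rewrite ?four0 ?two0.
    by rewrite lE subrr.
  transitivity (h x1
      + (x - x1) * (3 * x1 ^+ 2 + b2 W / 2 * x1 + b4 W / 2 - 2 * l * (l * x1 + m))).
    by rewrite /h x3l /cubic; field; rewrite ?four0 ?two0.
  by rewrite h1 tangent mulr0 addr0.
have x12 : x1 - x2 != 0 by rewrite subr_eq0.
have E2 : completed_y x2 y2 = l * x2 + m.
  have lE : y2 = y1 + l0 * (x2 - x1).
    by rewrite /l0 /slope (negbTE nx) divfK ?subr_eq0 1?eq_sym // addrC subrK.
  by rewrite lE /m /l /completed_y; field.
split=> // x; apply/(mulfI x12); rewrite mulr0.
have h2 : h x2 = 0 by rewrite /h -E2 g2; ring.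
transitivity (h x1 * (x - x2) - h x2 * (x - x1)); last by rewrite h1 h2 !mul0r subrr.
by rewrite /h x3l /cubic; field; rewrite ?four0 ?two0.
Qed.

Lemma add_point_opp x1 y1 x2 y2 :
  add_point W (Affine x1 y1) (Affine x2 y2) = Infinity ->
  x2 = x1 /\ completed_y x2 y2 = - completed_y x1 y1.
Proof.
by move=> /=; case: ifP => // /andP[/eqP<- /eqP->] _; split=> //; rewrite /completed_y; field.
Qed.

End ChordTangent.

Lemma rational_point_inj (F : fieldType) (E : elliptic_curve F) :
  injective (@point_of F E).
Proof. by case=> p hp [q hq] /= pq; case: q / pq hq => hq; rewrite (bool_irrelevance hp hq). Qed.

(** * Extracting the parameter from points of order 2, 3 and 4 *)

Section EmbeddingParameter.
Variable F : fieldType.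
Hypothesis two0 : 2 != 0 :> F.

(** The vanishing symmetric function determines r1, so only the ratio t = r2 / r3 matters. The two
    square conditions then become the equations for a and b. *)
Lemma square_diffs_parameter (r1 r2 r3 m n : F) :
  r2 ^+ 2 - r1 ^+ 2 = m ^+ 2 -> r3 ^+ 2 - r1 ^+ 2 = n ^+ 2 ->
  r1 * r2 + r1 * r3 + r2 * r3 = 0 ->
  r1 ^+ 2 != r2 ^+ 2 -> r1 ^+ 2 != r3 ^+ 2 -> r2 ^+ 2 != r3 ^+ 2 ->
  exists2 P : F * F, on_X P & noncusp P.1.
Proof.
move=> mE nE r123 r12 r13 r23.
have r20 : r2 != 0.
  apply/eqP => r20; move: r123 r12 r23; rewrite r20 mulr0 mul0r add0r addr0 => /eqP.
  by rewrite mulf_eq0 => /orP[]/eqP->; rewrite eqxx.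
have r30 : r3 != 0.
  apply/eqP => r30; move: r123 r13 r23; rewrite r30 !mulr0 !addr0 => /eqP.
  by rewrite mulf_eq0 => /orP[]/eqP->; rewrite eqxx.
have s0 : r2 + r3 != 0.
  apply/eqP => s0; have /eqP : r2 * r3 = 0 by rewrite -r123 -mulrDr s0 mulr0 add0r.
  by rewrite mulf_eq0 (negbTE r20) (negbTE r30).
have r1E : r1 = - (r2 * r3) / (r2 + r3).
  by apply: (mulIf s0); rewrite divfK //; apply/eqP; rewrite -subr_eq0 opprK mulrDr r123.
have m0 : m != 0 by rewrite -sqrf_eq0 -mE subr_eq0 eq_sym.
have n0 : n != 0 by rewrite -sqrf_eq0 -nE subr_eq0 eq_sym.
(* Here k = t + 1, so that a^2 = t^2 + 2 t and b^2 = 2 t + 1. *)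
pose k := (r2 + r3) / r3; pose a := m * k / r2; pose b := n * k / r3.
have k0 : k != 0 by rewrite mulf_neq0 ?invr_eq0.
have a0 : a != 0 by rewrite !mulf_neq0 ?invr_eq0.
have b0 : b != 0 by rewrite !mulf_neq0 ?invr_eq0.
have aE : a ^+ 2 = k ^+ 2 - 1.
  by rewrite /a expr_div_n exprMn -mE r1E /k; field; rewrite r20 r30 s0.
have bE : b ^+ 2 = 2 * k - 1.
  by rewrite /b expr_div_n exprMn -nE r1E /k; field; rewrite r30 s0.
(* The roots of x^2 - 2 k x + 1 are k + a and k - a; either one has [t_of x] = k - 1. *)
pose x := k + a; have xE : x ^+ 2 = 2 * k * x - 1.
  by rewrite /x; transitivity (k ^+ 2 + 2 * k * a + a ^+ 2); [ring|rewrite aE; ring].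
have x0 : x != 0.
  by apply: contra_eq_neq xE => ->; rewrite expr0n mulr0 sub0r eq_sym oppr_eq0 oner_eq0.
exists (x, b * x).
  rewrite /on_X /= exprMn bE; transitivity (x * (2 * k * x - 1) - x ^+ 2 + x); first by ring.
  by rewrite -xE; ring.
apply/and5P; split=> //=.
- apply/eqP => x1; have kx : k * x = 1.
    by apply: (mulfI two0); transitivity (x ^+ 2 + 1); [rewrite xE; ring|rewrite x1; ring].
  have kE : k = x by rewrite -[k]mulr1 -x1 expr2 mulrA kx mul1r.
  by move: a0; rewrite -sqrf_eq0 aE kE x1 subrr eqxx.
- by rewrite xE subrK mulf_neq0 // mulf_neq0.
- have -> : x ^+ 2 - x + 1 = b ^+ 2 * x by rewrite xE bE; ring.
  by rewrite mulf_neq0 // expf_neq0.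
have -> : x ^+ 2 - 4 * x + 1 = 2 * (r2 - r3) / r3 * x by rewrite xE /k; field; rewrite r30.
rewrite !mulf_neq0 ?invr_eq0 // subr_eq0.
by apply: contraNneq r23 => ->.
Qed.

Variables (E : elliptic_curve F) (f : 'Z_2 * 'Z_12 -> rational_point E).
Hypotheses (f_inj : injective f) (fD : {morph f : a b / a + b >-> add_rational_point a b}).

Let X g := if point_of (f g) is Affine x y then x else 0.
Let Y g := if point_of (f g) is Affine x y then completed_y E x y else 0.

(** Let e1, e2, e3 be the roots of the cubic, e1 belonging to [T1] = 2 [Q]. Halving [T1] makes e1 -
    e2 and e1 - e3 squares. The flex [R] makes each X(R) - e_i a square r_i^2, with r1, r2, r3 the
    roots of a cubic that has no linear term. *)
Lemma embedding_parameter : exists2 P : F * F, on_X P & noncusp P.1.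
Proof.
have fDp g h : point_of (f (g + h)) = add_point E (f g) (f h) by rewrite fD.
(* An affine [f 0] would be its own double, which forces it to be its own opposite, the case where
   the sum is infinity. *)
have f0 : point_of (f 0) = Infinity.
  have := fDp 0 0; rewrite addr0; case: (f 0) => p /= _.
  case: p => //= x y; case: ifP => // /negbT nopp [xE yE]; case/negP: nopp.
  move: xE yE; set x3 := _ - x - x => xE.
  by rewrite xE subrr mulr0 add0r => /eqP->; rewrite eqxx.
have aff g : g != 0 -> exists x y, [/\ point_of (f g) = Affine x y,
    on_curve E (Affine x y), X g = x & Y g = completed_y E x y].
  rewrite /X /Y; move=> g0; have := point_of_on_curve (f g).
  case fg : (point_of (f g)) => [|x y] C; last by exists x, y.
  by case/eqP: g0; apply/f_inj/rational_point_inj; rewrite fg f0.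
have line g h : g != 0 -> h != 0 -> g + h != 0 -> exists l m,
    [/\ Y g = l * X g + m, Y h = l * X h + m, Y (g + h) = - (l * X (g + h) + m)
    & forall x, cubic E x = (l * x + m) ^+ 2 + (x - X g) * (x - X h) * (x - X (g + h))].
  move=> /aff[x1 [y1 [E1 C1 -> ->]]] /aff[x2 [y2 [E2 C2 -> ->]]] /aff[x3 [y3 [E3 C3 -> ->]]].
  by apply: add_point_line => //; rewrite -E1 -E2 -E3 -fDp.
have opp g h : g != 0 -> h != 0 -> g + h = 0 -> X h = X g /\ Y h = - Y g.
  move=> /aff[x1 [y1 [E1 C1 -> ->]]] /aff[x2 [y2 [E2 C2 -> ->]]] gh.
  by apply: add_point_opp => //; rewrite -E1 -E2 -fDp gh.
have XY_inj g h : g != 0 -> h != 0 -> X g = X h -> Y g = Y h -> g = h.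
  move=> /aff[x1 [y1 [E1 _ -> ->]]] /aff[x2 [y2 [E2 _ -> ->]]] xE; subst x2.
  rewrite /completed_y => /addIr yE; apply/f_inj/rational_point_inj.
  by rewrite E1 E2 yE.
have YX g : g != 0 -> cubic E (X g) = Y g ^+ 2.
  by move=> /aff[x [y [_ C -> ->]]]; exact: cubic_on_curve.
pose T1 : 'Z_2 * 'Z_12 := (0, 6%:R); pose T2 : 'Z_2 * 'Z_12 := (1, 0).
pose T3 : 'Z_2 * 'Z_12 := (1, 6%:R); pose Q : 'Z_2 * 'Z_12 := (0, 3%:R).
pose R : 'Z_2 * 'Z_12 := (0, 4%:R).
have T10 : T1 != 0 by []. have T20 : T2 != 0 by []. have T30 : T3 != 0 by [].
have Y0 g : g != 0 -> g + g = 0 -> Y g = 0.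
  move=> g0 gg; have [_ /eqP] := opp g g g0 g0 gg.
  by rewrite -addr_eq0 -mulr2n -mulr_natr mulf_eq0 (negbTE two0) orbF => /eqP.
have Y1 : Y T1 = 0 by apply: Y0 => //; apply/eqP.
have Y2 : Y T2 = 0 by apply: Y0 => //; apply/eqP.
have Y3 : Y T3 = 0 by apply: Y0 => //; apply/eqP.
have X12 : X T1 != X T2 by apply/eqP => /XY_inj; rewrite Y1 Y2 => /(_ T10 T20 erefl)/eqP.
have X13 : X T1 != X T3 by apply/eqP => /XY_inj; rewrite Y1 Y3 => /(_ T10 T30 erefl)/eqP.
have X23 : X T2 != X T3 by apply/eqP => /XY_inj; rewrite Y2 Y3 => /(_ T20 T30 erefl)/eqP.
have c1 : cubic E (X T1) = 0 by rewrite YX // Y1 expr0n.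
have c2 : cubic E (X T2) = 0 by rewrite YX // Y2 expr0n.
have c3 : cubic E (X T3) = 0 by rewrite YX // Y3 expr0n.
have [l [m [_ _ tQ cQ]]] := line Q Q isT isT isT.
have QQ : Q + Q = T1 by apply/eqP.
rewrite QQ in tQ cQ.
have lT1 : l * X T1 + m = 0 by apply/eqP; rewrite -oppr_eq0 -tQ Y1.
have sqQ e : cubic E e = 0 -> e != X T1 -> (l * (e - X T1)) ^+ 2 = (e - X Q) ^+ 2 * (X T1 - e).
  move=> ce ne; rewrite cQ in ce.
  have -> : l * (e - X T1) = l * e + m.
    by transitivity (l * e + m - (l * X T1 + m)); [ring|rewrite lT1 subr0].
  by apply/eqP; rewrite -subr_eq0 -ce; apply/eqP; ring.
have l0 : l != 0.
  apply: contraNneq X23 => l0.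
  have XQ e : cubic E e = 0 -> e != X T1 -> e = X Q.
    move=> ce ne; have /esym/eqP := sqQ e ce ne; rewrite l0 mul0r expr0n mulf_eq0 sqrf_eq0.
    by rewrite !subr_eq0 [X T1 == e]eq_sym (negbTE ne) orbF => /eqP.
  by apply/eqP; rewrite (XQ _ c2) 1?eq_sym // (XQ _ c3) // eq_sym.
have halves e : cubic E e = 0 -> e != X T1 -> X T1 - e = (l * (e - X T1) / (e - X Q)) ^+ 2.
  move=> ce ne; have := sqQ e ce ne => sq; rewrite expr_div_n sq mulrC mulKf //.
  apply: contraTneq isT => eQ; move/eqP: sq; rewrite eQ mul0r sqrf_eq0 mulf_eq0.
  by rewrite (negbTE l0) subr_eq0 (negbTE ne).
have [L [M [RL _ tR cR]]] := line R R isT isT isT.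
have R2 : R + R != 0 by [].
have [XR YR] : X (R + R) = X R /\ Y (R + R) = - Y R.
  by apply: (opp R (R + R)) => //; apply/eqP.
rewrite XR in cR.
have YR0 : Y R != 0.
  apply/eqP => YR0; have := XY_inj R (R + R) isT R2 (esym XR).
  by rewrite YR YR0 oppr0 => /(_ erefl)/eqP.
(* At order 3 the tangent meets the curve triply, so (L e + M)^2 = (X(R) - e)^3. The choice r = (L e
   + M) / (X(R) - e) fixes the sign by r^3 = L e + M. *)
have flex e : cubic E e = 0 -> exists2 r, X R - e = r ^+ 2
    & r ^+ 3 + L * r ^+ 2 = L * X R + M.
  move=> ce; have Re : X R - e != 0.
    rewrite subr_eq0; apply: contraNneq YR0 => Re.
    by rewrite -sqrf_eq0 -YX // Re ce.
  have cube : (L * e + M) ^+ 2 = (X R - e) ^+ 3.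
    by rewrite cR in ce; apply/eqP; rewrite -subr_eq0 -ce; apply/eqP; ring.
  exists ((L * e + M) / (X R - e)).
    by rewrite expr_div_n cube; field.
  have -> : ((L * e + M) / (X R - e)) ^+ 3 = L * e + M.
    by rewrite expr_div_n exprS cube mulfK // expf_neq0.
  by rewrite expr_div_n cube; field.
have [r1 r1E r1c] := flex _ c1; have [r2 r2E r2c] := flex _ c2; have [r3 r3E r3c] := flex _ c3.
have sq_neq e e' r r' : X R - e = r ^+ 2 -> X R - e' = r' ^+ 2 -> e != e' -> r ^+ 2 != r' ^+ 2.
  by move=> <- <-; apply: contra_neq => /addrI/oppr_inj.
have n12 := sq_neq _ _ _ _ r1E r2E X12; have n13 := sq_neq _ _ _ _ r1E r3E X13.
have n23 := sq_neq _ _ _ _ r2E r3E X23.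
apply: (@square_diffs_parameter r1 r2 r3 _ _ _ _ _ n12 n13 n23).
- rewrite -r1E -r2E; transitivity (X T1 - X T2); first by ring.
  by apply: halves => //; rewrite eq_sym.
- rewrite -r1E -r3E; transitivity (X T1 - X T3); first by ring.
  by apply: halves => //; rewrite eq_sym.
have neq_of r r' : r ^+ 2 != r' ^+ 2 -> r - r' != 0.
  by move=> rr; rewrite subr_eq0; apply: contraNneq rr => ->.
have d0 : (r1 - r2) * (r1 - r3) * (r2 - r3) != 0 by rewrite !mulf_neq0 ?neq_of.
apply/eqP; rewrite -(mulrI_eq0 _ (mulfI d0)); apply/eqP.
(* Lagrange interpolation of z^3 + L z^2 at its three equal values r1, r2, r3 *)
transitivity ((r1 ^+ 2 - r2 ^+ 2) * (r3 ^+ 3 + L * r3 ^+ 2 - (L * X R + M))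
  + (r2 ^+ 2 - r3 ^+ 2) * (r1 ^+ 3 + L * r1 ^+ 2 - (L * X R + M))
  + (r3 ^+ 2 - r1 ^+ 2) * (r2 ^+ 3 + L * r2 ^+ 2 - (L * X R + M))); first by ring.
by rewrite r1c r2c r3c !subrr !mulr0 !addr0.
Qed.

End EmbeddingParameter.

(** * From a point of the modular curve to a torsion subgroup *)

(* Polynomials in t with integer coefficients, lowest degree first. *)
Definition zpoly := seq Z.

Fixpoint zadd (p q : zpoly) : zpoly :=
  match p, q with
  | [::], _ => q
  | _, [::] => p
  | c :: p', d :: q' => c + d :: zadd p' q'
  end.

Definition zscale (c : Z) (p : zpoly) : zpoly := [seq c * d | d <- p].

Fixpoint zmul (p q : zpoly) : zpoly :=
  if p is c :: p' then zadd (zscale c q) (0 :: zmul p' q) else [::].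

Definition zsub p q : zpoly := zadd p (zscale (-1) q).
Definition zzero (p : zpoly) : bool := all (pred1 0) p.

(* Quotient of p by d + c * t, when this division is exact. *)
Definition zdiv_linear (d c : Z) (p : zpoly) : zpoly :=
  (foldr (fun e hq => (Z.div (e - d * hq.1) c, hq.1 :: hq.2)) (0, [::]) p).2.

(* The zeros in t of the cuspidal locus. *)
Definition cusp_factors : seq (Z * Z) :=
  [:: (0, 1); (2, 1); (1, 2); (-1, 1); (1, 1)].

Definition zconstant (p : zpoly) : bool :=
  if p is c :: p' then (c != 0) && zzero p' else false.

Definition zquotients (p : zpoly) : seq zpoly :=
  [seq zdiv_linear f.1 f.2 p | f <- cusp_factors
    & zzero (zsub p (zmul [:: f.1; f.2] (zdiv_linear f.1 f.2 p)))].

(* p is a nonzero constant times a product of cusp factors. *)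
Fixpoint zcuspidal (fuel : nat) (p : zpoly) : bool :=
  if zconstant p then true else
  if fuel is n.+1 then
    if zquotients p is q :: _ then zcuspidal n q else false
  else false.

(* The element p + q a + (r + s a) b of Z[t, a, b] with a^2 = t^2 + 2 t and
   b^2 = 2 t + 1 is encoded as ((p, q), (r, s)). *)
Definition zquad := ((zpoly * zpoly) * (zpoly * zpoly))%type.

Definition aadd (u v : zpoly * zpoly) := (zadd u.1 v.1, zadd u.2 v.2).
Definition ascale (c : Z) (u : zpoly * zpoly) := (zscale c u.1, zscale c u.2).
Definition amul (u v : zpoly * zpoly) :=
  (zadd (zmul u.1 v.1) (zmul [:: 0; 2; 1] (zmul u.2 v.2)),
   zadd (zmul u.1 v.2) (zmul u.2 v.1)).
Definition b_sqr : zpoly * zpoly := ([:: 1; 2], [::]).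

Definition qadd (u v : zquad) : zquad := (aadd u.1 v.1, aadd u.2 v.2).
Definition qscale (c : Z) (u : zquad) : zquad := (ascale c u.1, ascale c u.2).
Definition qmul (u v : zquad) : zquad :=
  (aadd (amul u.1 v.1) (amul b_sqr (amul u.2 v.2)),
   aadd (amul u.1 v.2) (amul u.2 v.1)).
Definition qsub (u v : zquad) := qadd u (qscale (-1) v).
Definition qzero (u : zquad) :=
  [&& zzero u.1.1, zzero u.1.2, zzero u.2.1 & zzero u.2.2].
Definition qeq u v := qzero (qsub u v).

Definition anorm (u : zpoly * zpoly) : zpoly :=
  zsub (zmul u.1 u.1) (zmul [:: 0; 2; 1] (zmul u.2 u.2)).
Definition qnorm (u : zquad) : zpoly :=
  anorm (aadd (amul u.1 u.1) (ascale (-1) (amul b_sqr (amul u.2 u.2)))).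
(** A norm that is a product of cusp factors certifies nonvanishing at every noncuspidal t; 40
    bounds the number of factors. *)
Definition qnonzero (u : zquad) : bool := zcuspidal 40 (qnorm u).

Definition qconst (c : Z) : zquad := (([:: c], [::]), ([::], [::])).
Definition qt : zquad := (([:: 0; 1], [::]), ([::], [::])).
Definition qa : zquad := (([::], [:: 1]), ([::], [::])).
Definition qb : zquad := (([::], [::]), ([:: 1], [::])).

(** * Soundness of the polynomial arithmetic under specialisation *)

Section Eval.
Variables (F : fieldType) (t a b : F).
Hypotheses (aE : a ^+ 2 = t ^+ 2 + 2 * t) (bE : b ^+ 2 = 2 * t + 1).

Definition zF (c : Z) : F := (int_of_Z c)%:~R.
Definition zeval (p : zpoly) : F := foldr (fun c e => zF c + t * e) 0 p.
Definition aeval (u : zpoly * zpoly) : F := zeval u.1 + zeval u.2 * a.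
Definition qeval (u : zquad) : F := aeval u.1 + aeval u.2 * b.

Lemma zF_D c d : zF (c + d) = zF c + zF d. Proof. by rewrite /zF !rmorphD. Qed.
Lemma zF_M c d : zF (c * d) = zF c * zF d. Proof. by rewrite /zF !rmorphM. Qed.

Lemma zF0 : zF 0 = 0. Proof. by rewrite /zF !rmorph0. Qed.
Lemma zF_N1 : zF (-1) = -1. Proof. by rewrite /zF !rmorphN1. Qed.
Lemma zF1 : zF 1 = 1. Proof. by rewrite /zF !rmorph1. Qed.
Lemma zF2 : zF 2 = 2. Proof. by rewrite /zF (_ : int_of_Z 2 = 2). Qed.
Lemma zeval_cons c p : zeval (c :: p) = zF c + t * zeval p. Proof. by []. Qed.
Lemma zeval_nil : zeval [::] = 0. Proof. by []. Qed.
Arguments zeval _ : simpl never.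

Lemma zevalD p q : zeval (zadd p q) = zeval p + zeval q.
Proof.
by elim: p q => [|c p IH] [|d q]; rewrite /= ?zeval_nil ?add0r ?addr0 // !zeval_cons zF_D IH; ring.
Qed.

Lemma zevalZ c p : zeval (zscale c p) = zF c * zeval p.
Proof.
by elim: p => [|d p IH]; rewrite /= ?zeval_nil ?mulr0 // !zeval_cons zF_M IH; ring.
Qed.

Lemma zevalM p q : zeval (zmul p q) = zeval p * zeval q.
Proof.
elim: p => [|c p IH] /=; first by rewrite zeval_nil mul0r.
by rewrite zevalD zevalZ !zeval_cons zF0 IH; ring.
Qed.

Lemma zevalB p q : zeval (zsub p q) = zeval p - zeval q.
Proof. by rewrite zevalD zevalZ zF_N1 mulN1r. Qed.

Lemma zeval0 p : zzero p -> zeval p = 0.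
Proof.
by elim: p => //= c p IH /andP[/eqP-> /IH E]; rewrite zeval_cons E zF0 mulr0 addr0.
Qed.

Lemma aevalE p q : aeval (p, q) = zeval p + zeval q * a. Proof. by []. Qed.
Lemma qevalE u v : qeval (u, v) = aeval u + aeval v * b. Proof. by []. Qed.

Lemma aevalD u v : aeval (aadd u v) = aeval u + aeval v.
Proof. by rewrite /aadd aevalE !zevalD /aeval; ring. Qed.
Lemma aevalZ c u : aeval (ascale c u) = zF c * aeval u.
Proof. by rewrite /ascale aevalE !zevalZ /aeval; ring. Qed.

Let A_E : zeval [:: 0; 2; 1] = t ^+ 2 + 2 * t.
Proof. by rewrite !zeval_cons zF0 zF1 zF2 zeval_nil; ring. Qed.
Let B_E : aeval b_sqr = 2 * t + 1.
Proof. by rewrite aevalE !zeval_cons zF1 zF2 zeval_nil; ring. Qed.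

Lemma aevalM u v : aeval (amul u v) = aeval u * aeval v.
Proof.
rewrite /amul aevalE; move: A_E; generalize ([:: 0; 2; 1] : zpoly) => A AE.
by rewrite !zevalD !zevalM AE -aE /aeval; ring.
Qed.

Lemma qevalD u v : qeval (qadd u v) = qeval u + qeval v.
Proof. by rewrite /qadd qevalE !aevalD /qeval; ring. Qed.
Lemma qevalZ c u : qeval (qscale c u) = zF c * qeval u.
Proof. by rewrite /qscale qevalE !aevalZ /qeval; ring. Qed.
Lemma qevalM u v : qeval (qmul u v) = qeval u * qeval v.
Proof. by rewrite /qmul qevalE !aevalD !aevalM B_E -bE /qeval; ring. Qed.
Lemma qevalB u v : qeval (qsub u v) = qeval u - qeval v.
Proof. by rewrite qevalD qevalZ zF_N1 mulN1r. Qed.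

Lemma qevalN u : qeval (qscale (-1) u) = - qeval u.
Proof. by rewrite qevalZ zF_N1 mulN1r. Qed.

Lemma qeval_eq u v : qeq u v -> qeval u = qeval v.
Proof.
move=> /and4P[/zeval0 e1 /zeval0 e2 /zeval0 e3 /zeval0 e4].
apply/subr0_eq; rewrite -qevalB /qeval /aeval e1 e2 e3 e4; ring.
Qed.

Lemma qeval_const c : qeval (qconst c) = zF c.
Proof. by rewrite qevalE !aevalE zeval_cons !zeval_nil; ring. Qed.

Hypothesis char0 : forall n, (n%:R == 0 :> F) = (n == 0)%N.
Hypothesis noncusp_t : [&& t != 0, t + 2 != 0, 2 * t + 1 != 0, t - 1 != 0 & t + 1 != 0].

Lemma zF_neq0 c : c != 0 -> zF c != 0.
Proof.
move=> c0; have : int_of_Z c != 0 by rewrite -(inj_eq (can_inj int_of_ZK)) in c0 *.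
rewrite /zF; case: (int_of_Z c) => n n0; first by rewrite -pmulrn char0.
by rewrite NegzE rmorphN oppr_eq0 /= -pmulrn char0.
Qed.

Lemma cusp_factor_neq0 f : f \in cusp_factors -> zF f.1 + t * zF f.2 != 0.
Proof.
have [t0 t2 t21 tm tp] := and5P noncusp_t.
rewrite !inE => /or4P[/eqP->|/eqP->|/eqP->|/orP[/eqP->|/eqP->]];
  rewrite /= ?zF0 ?zF1 ?zF2 ?zF_N1 ?mulr1; last first.
- by rewrite addrC.
- by rewrite addrC.
- by rewrite addrC mulrC.
- by rewrite addrC.
by rewrite add0r.
Qed.

Lemma zcuspidal_neq0 n p : zcuspidal n p -> zeval p != 0.
Proof.
have const q : zconstant q -> zeval q != 0.
  by case: q => // c q /andP[c0 /zeval0 E]; rewrite zeval_cons E mulr0 addr0 zF_neq0.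
elim: n p => [|n IH] p /=; first by case: ifP => // /const.
case: ifP => [/const//|_].
case E : (zquotients p) => [//|q l] /IH q0.
have : q \in q :: l by rewrite inE eqxx.
rewrite -E => /mapP[f]; rewrite mem_filter => /andP[/zeval0 pE ff] qE.
rewrite -qE in pE; move/eqP: pE; rewrite zevalB zevalM subr_eq0 => /eqP->.
by rewrite mulf_neq0 // !zeval_cons zeval_nil mulr0 addr0 cusp_factor_neq0.
Qed.

(** The norm is a multiple of u: conjugating b and then a supplies the cofactors, so a zero of u is
    a zero of its norm. *)
Lemma qnonzero_neq0 u : qnonzero u -> qeval u != 0.
Proof.
move=> /zcuspidal_neq0; apply: contraNneq => u0.
rewrite /qnorm; set v := aadd _ _; have v0 : aeval v = 0.
  rewrite /v aevalD aevalZ !aevalM zF_N1 B_E -bE.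
  transitivity (qeval u * (aeval u.1 - aeval u.2 * b)); last by rewrite u0 mul0r.
  by rewrite /qeval; ring.
rewrite /anorm; move: A_E; generalize ([:: 0; 2; 1] : zpoly) => A AE.
rewrite zevalB !zevalM AE -aE.
apply/eqP; transitivity (aeval v * (zeval v.1 - zeval v.2 * a)); last by rewrite v0 mul0r.
by rewrite /aeval; ring.
Qed.

End Eval.

(* The universal table of the 24 torsion points *)
Declare Scope quad_scope.
Delimit Scope quad_scope with quad.
Bind Scope quad_scope with zquad.
Notation "x + y" := (qadd x y) : quad_scope.
Notation "x - y" := (qsub x y) : quad_scope.
Notation "x * y" := (qmul x y) : quad_scope.
Notation "- x" := (qscale (-1) x) : quad_scope.
Notation "c %:q" := (qconst c) (at level 2, format "c %:q") : quad_scope.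

(* The curve y^2 = x (x + t^2 a^2) (x + b^2). *)
Definition qa2 : zquad := (qt * qt * (qa * qa) + qb * qb)%quad.
Definition qa4 : zquad := (qt * qt * (qa * qa) * (qb * qb))%quad.

(** Entry (i, j) is i T + j S with T = (-t^2 a^2, 0) and S of order 12. The default branches hold
    the 2-torsion points at j = 6, and the points with j > 6 are opposites of those with 12 - j. *)
Definition half_table (i j : nat) : zquad * zquad :=
  let t := qt in let a := qa in let b := qb in let s := (qt + 1%:q)%quad in
  (match i, j with
   | 0%N, 1%N => (a * b * (a + s) * (b + s), a * b * (a + s) * (b + s) * s * (a + b))
   | 0%N, 2%N => (a * a * b * b, a * a * b * b * s * s)
   | 0%N, 3%N => (t * a * b, t * a * b * (t * a + b))
   | 0%N, 4%N => (t * t, t * t * s * s)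
   | 0%N, 5%N => (a * b * (a - s) * (b - s), a * b * (a - s) * (b - s) * s * (a + b))
   | 0%N, _ => (0%:q, 0%:q)
   | _, 0%N => (- (t * t * a * a), 0%:q)
   | _, 1%N => (a * b * (a + s) * (b - s), a * b * (a + s) * (b - s) * s * (a - b))
   | _, 2%N => (- (b * b * t * t), - (b * b * t * t * (t * t - 1%:q)))
   | _, 3%N => (- (t * a * b), - (t * a * b * (t * a - b)))
   | _, 4%N => (- (a * a), - (a * a * (t * t - 1%:q)))
   | _, 5%N => (a * b * (a - s) * (b + s), a * b * (a - s) * (b + s) * s * (a - b))
   | _, _ => (- (b * b), 0%:q)
   end)%quad.

Definition torsion_table (i j : nat) : option (zquad * zquad) :=
  if (i == 0)%N && (j == 0)%N then None
  else if (j <= 6)%N then Some (half_table i j)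
  else let P := half_table i (12 - j) in Some (P.1, qscale (-1) P.2).

Definition check_on (P : option (zquad * zquad)) : bool :=
  if P is Some (x, y) then qeq (y * y)%quad (x * x * x + qa2 * x * x + qa4 * x)%quad
  else true.

(** The slope is n / d and the addition formulas are tested with denominators cleared. Certifying d
    nonzero keeps the same case of the group law valid after specialisation. *)
Definition check_add (P Q R : option (zquad * zquad)) : bool :=
  match P, Q, R with
  | None, None, None => true
  | None, Some (x, y), Some (x', y') | Some (x, y), None, Some (x', y') =>
      qeq x x' && qeq y y'
  | Some (x1, y1), Some (x2, y2), None => qeq x1 x2 && qeq y2 (- y1)%quad
  | Some (x1, y1), Some (x2, y2), Some (x3, y3) =>
      let tangent := qeq x1 x2 in
      let d := (if tangent then 2%:q * y1 else x2 - x1)%quad in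
      let n := (if tangent then 3%:q * x1 * x1 + 2%:q * qa2 * x1 + qa4 else y2 - y1)%quad in
      [&& (tangent ==> qeq y1 y2), qnonzero d,
          qeq (n * n)%quad ((x3 + qa2 + x1 + x2) * d * d)%quad
        & qeq (n * (x3 - x1) + y1 * d)%quad (- (y3 * d))%quad]
  | _, _, _ => false
  end.

Definition indices : seq (nat * nat) := [seq (i, j) | i <- iota 0 2, j <- iota 0 12].

Lemma torsion_table_on : all (fun g => check_on (torsion_table g.1 g.2)) indices.
Proof. by vm_compute. Qed.

Lemma torsion_table_add :
  all (fun g => all (fun h => check_add (torsion_table g.1 g.2) (torsion_table h.1 h.2)
    (torsion_table ((g.1 + h.1) %% 2) ((g.2 + h.2) %% 12))) indices) indices.
Proof. by vm_compute. Qed.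

(** This is Y^2 = X (X + t^2 a^2) (X + b^2) with a^2 and b^2 eliminated, so the model depends on t
    alone. *)
Definition modular_curve (F : fieldType) (t : F) : weierstrass F :=
  {| a1 := 0; a2 := t ^+ 3 * (t + 2) + (2 * t + 1); a3 := 0;
     a4 := t ^+ 3 * (t + 2) * (2 * t + 1); a6 := 0 |}.

(** * Specialising the table to a subgroup over a field *)

Section ModularEmbedding.
Variables (F : fieldType) (t a b : F).
Hypotheses (aE : a ^+ 2 = t ^+ 2 + 2 * t) (bE : b ^+ 2 = 2 * t + 1).
Hypothesis char0 : forall n, (n%:R == 0 :> F) = (n == 0)%N.
Hypothesis noncusp_t : [&& t != 0, t + 2 != 0, 2 * t + 1 != 0, t - 1 != 0 & t + 1 != 0].

Let ev := qeval t a b.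
Let W := modular_curve t.

Let evD u v : ev (qadd u v) = ev u + ev v. Proof. exact: qevalD. Qed.
Let evM u v : ev (qmul u v) = ev u * ev v. Proof. exact: qevalM. Qed.
Let evB u v : ev (qsub u v) = ev u - ev v. Proof. exact: qevalB. Qed.
Let evN u : ev (qscale (-1) u) = - ev u. Proof. exact: qevalN. Qed.
Let ev_eq u v : qeq u v -> ev u = ev v. Proof. exact: qeval_eq. Qed.
Let ev_neq0 u : qnonzero u -> ev u != 0. Proof. exact: qnonzero_neq0. Qed.

Let ev2 : ev (qconst 2) = 2. Proof. by rewrite /ev qeval_const zF2. Qed.
Let ev3 : ev (qconst 3) = 3.
Proof. by rewrite /ev qeval_const /zF (_ : int_of_Z 3 = 3). Qed.

Let ev_t : ev qt = t.
Proof. by rewrite /ev qevalE !aevalE !zeval_cons !zeval_nil zF0 zF1; ring. Qed.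
Let ev_a : ev qa = a.
Proof. by rewrite /ev qevalE !aevalE !zeval_cons !zeval_nil zF1; ring. Qed.
Let ev_b : ev qb = b.
Proof. by rewrite /ev qevalE !aevalE !zeval_cons !zeval_nil zF1; ring. Qed.

Let ev_a2 : ev qa2 = a2 W.
Proof. by rewrite /qa2 !(evD, evM) ev_t ev_a ev_b /=; ring: aE bE. Qed.
Let ev_a4 : ev qa4 = a4 W.
Proof. by rewrite /qa4 !evM ev_t ev_a ev_b /=; ring: aE bE. Qed.

Definition table_point (P : option (zquad * zquad)) : Defs.point F :=
  if P is Some (x, y) then Affine (ev x) (ev y) else Infinity.

Lemma check_on_sound P : check_on P -> on_curve W (table_point P).
Proof.
case: P => // -[x y]; rewrite /check_on; move: ev_a2 ev_a4.
generalize qa2 qa4 => A2 A4 A2E A4E /ev_eq.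
rewrite !(evD, evM) A2E A4E /= => E.
by apply/eqP => /=; transitivity (ev y * ev y); [ring|rewrite E; ring].
Qed.

Lemma check_add_sound P Q R : check_add P Q R ->
  add_point W (table_point P) (table_point Q) = table_point R.
Proof.
have two0 : 2 != 0 :> F by rewrite char0.
case: P => [[x1 y1]|]; case: Q => [[x2 y2]|]; case: R => [[x3 y3]|] //.
- rewrite /check_add /table_point /add_point; move: ev_a2 ev_a4.
  generalize qa2 qa4 => A2 A4 A2E A4E.
  move=> /and4P[/implyP xy /ev_neq0 d0 /ev_eq n2 /ev_eq nd].
  have [l lE nE] : exists2 l, l = slope W (ev x1) (ev y1) (ev x2) (ev y2)
      & (ev x1 == ev x2) && (ev y2 == - ev y1 - 0 * ev x1 - 0) = false /\
        l ^+ 2 - a2 W - ev x1 - ev x2 = ev x3 /\ l * (ev x3 - ev x1) + ev y1 = - ev y3.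
    exists (slope W (ev x1) (ev y1) (ev x2) (ev y2)) => //.
    rewrite /slope; move: xy d0 n2 nd; case: ifP => [/ev_eq xE|xNE].
      move=> /(_ isT)/ev_eq yE; rewrite !(evD, evM, evB, evN) ev2 ev3 A2E A4E => d0 n2 nd.
      rewrite xE eqxx -yE; move: d0 n2 nd; rewrite xE; set n := 3 * _ * _ + _ + _; set d := 2 * _.
      move=> d0 n2 nd.
      have -> : 3 * ev x2 ^+ 2 + 2 * a2 W * ev x2 + a4 W - 0 * ev y1 = n by rewrite /n; ring.
      have -> : 2 * ev y1 + 0 * ev x2 + 0 = d by rewrite /d; ring.
      split; last split.
      - apply/negbTE; apply: contraNneq d0 => yy; rewrite /d.
        by apply/eqP; transitivity (ev y1 + ev y1); [ring|rewrite {1}yy; ring].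
      - by rewrite expr_div_n expr2 n2; field.
      - by apply: (mulIf d0); rewrite mulNr -nd; field.
    move=> _; rewrite !(evD, evM, evB, evN) A2E => d0 n2 nd.
    have x12 : ev x1 != ev x2 by rewrite eq_sym -subr_eq0.
    rewrite (negbTE x12) andFb; split=> //; split.
      by rewrite expr_div_n expr2 n2; field.
    by apply: (mulIf d0); rewrite mulNr -nd; field.
  case: nE => c [x3E y3E].
  move: c; rewrite /= -lE => ->; rewrite mul0r addr0 x3E y3E.
  by congr Affine; ring.
- move=> /andP[/ev_eq xE /ev_eq]; rewrite evN => yE /=.
  by rewrite xE yE eqxx mul0r !subr0 eqxx.
- by move=> /andP[/ev_eq xE /ev_eq yE] /=; rewrite xE yE.
- by move=> /andP[/ev_eq xE /ev_eq yE] /=; rewrite xE yE.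
Qed.

Lemma modular_curve_disc : discriminant W != 0.
Proof.
have [t0 t2 t21 tm tp] := and5P noncusp_t.
have -> : discriminant W =
    16 * (t ^+ 3 * (t + 2) * (2 * t + 1) * ((t - 1) * (t + 1) ^+ 3)) ^+ 2.
  by rewrite /discriminant /b2 /b4 /b6 /b8 /=; ring.
by rewrite mulf_neq0 ?char0 // expf_neq0 // !mulf_neq0 // expf_neq0.
Qed.

Lemma modular_embedding : exists2 E : elliptic_curve F,
  weierstrass_of E = W & embeds_in_points ('Z_2 * 'Z_12)%type E.
Proof.
pose E := EllipticCurve modular_curve_disc; exists E => //.
pose T (g : 'Z_2 * 'Z_12) := torsion_table g.1 g.2.
have idx (g : 'Z_2 * 'Z_12) : (g.1 : nat, g.2 : nat) \in indices.
  by apply: allpairs_f; rewrite mem_iota leq0n add0n; exact: ltn_ord.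
have Ton g : on_curve W (table_point (T g)).
  by apply: check_on_sound; exact: (allP torsion_table_on _ (idx g)).
have TD g h : add_point W (table_point (T g)) (table_point (T h)) = table_point (T (g + h)).
  by apply: check_add_sound; exact: (allP (allP torsion_table_add _ (idx g)) _ (idx h)).
pose f g : rational_point E := RationalPoint (E := E) (Ton g).
exists f; split=> [g h /(congr1 (@point_of _ E)) /= gh|g h]; last first.
  by apply: rational_point_inj; rewrite /= TD.
(* Injectivity reduces to a trivial kernel: only the index (0, 0) is tabulated as [None]. *)
have : table_point (T (g - h)) = Infinity by rewrite -TD gh TD subrr.
rewrite /T /torsion_table; case: ifP => [/andP[/eqP g1 /eqP g2] _|_]; last first.
  by case: ifP => _ /=; case: (half_table _ _).
apply/subr0_eq; case: (g - h) g1 g2 => u v /= u0 v0.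
have -> : u = 0 by exact: val_inj.
by have -> : v = 0 by exact: val_inj.
Qed.

End ModularEmbedding.

(** * Finiteness of the set of parameters with a given j-invariant *)

Definition c4 (F : fieldType) (W : weierstrass F) : F := b2 W ^+ 2 - 24 * b4 W.

Section JInvariant.
Variables (F G : fieldType) (iota : {rmorphism F -> G}).

Lemma c4_change_vars (u r s t : G) W : u != 0 -> c4 (change_vars u r s t W) = c4 W / u ^+ 4.
Proof. by move=> u0; rewrite /c4 /b2 /b4 /=; field. Qed.

Lemma discriminant_change_vars (u r s t : G) W :
  u != 0 -> discriminant (change_vars u r s t W) = discriminant W / u ^+ 12.
Proof. by move=> u0; rewrite /discriminant /b2 /b4 /b6 /b8 /=; field. Qed.

Lemma c4_map W : c4 (map_weierstrass iota W) = iota (c4 W).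
Proof. by rewrite /c4 /b2 /b4 /=; ring. Qed.

Lemma discriminant_map W : discriminant (map_weierstrass iota W) = iota (discriminant W).
Proof. by rewrite /discriminant /b2 /b4 /b6 /b8 /=; ring. Qed.

(** A change of variables divides c4 by u^4 and the discriminant by u^12, so j = c4^3 / discriminant
    is unchanged. The cross-multiplied equality descends along the injective [iota]. *)
Lemma isomorphic_over_j (E E' : elliptic_curve F) : isomorphic_over iota E E' ->
  c4 E ^+ 3 * discriminant E' = c4 E' ^+ 3 * discriminant E.
Proof.
move=> [u [r [s [t [u0 eqW]]]]]; apply: (fmorph_inj iota).
have cE := c4_map E; have dE := discriminant_map E.
have cE' := c4_map E'; have dE' := discriminant_map E'.
transitivity (iota (c4 E) ^+ 3 * iota (discriminant E')); first by ring.
transitivity (iota (c4 E') ^+ 3 * iota (discriminant E)); last by ring.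
rewrite -cE -dE -cE' -dE' -eqW.
by rewrite c4_change_vars // discriminant_change_vars //; field.
Qed.

End JInvariant.

(* Its roots are the t for which modular_curve t has j-invariant alpha / beta; it does
   not vanish at 0, where that curve is nodal. *)
Definition j_poly (F : fieldType) (alpha beta : F) : {poly F} :=
  let M := 'X ^+ 3 * ('X + 2%:P) in let N := 2%:P * 'X + 1 in
  (16%:P * (M ^+ 2 - M * N + N ^+ 2)) ^+ 3 * beta%:P
  - alpha%:P * (16%:P * (M * N * (M - N)) ^+ 2).

Lemma j_poly_modular (F : fieldType) (alpha beta t : F) :
  (j_poly alpha beta).[t] = c4 (modular_curve t) ^+ 3 * beta
    - alpha * discriminant (modular_curve t).
Proof.
rewrite /j_poly !hornerE /c4 /discriminant /b2 /b4 /b6 /b8 /=.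
ring.
Qed.

Lemma j_poly_neq0 (F : fieldType) (alpha beta : F) :
  2 != 0 :> F -> beta != 0 -> j_poly alpha beta != 0.
Proof.
move=> two0 beta0; have : (j_poly alpha beta).[0] != 0.
  rewrite j_poly_modular (_ : _ - _ = 2 ^+ 12 * beta); first by rewrite mulf_neq0 ?expf_neq0.
  by rewrite /c4 /discriminant /b2 /b4 /b6 /b8 /=; ring.
by apply: contraNneq => ->; rewrite horner0.
Qed.

Lemma modular_embedding_of_X (K : fieldExtType rat) (P : K * K) :
  on_X P -> noncusp P.1 ->
  exists2 E : elliptic_curve K, weierstrass_of E = modular_curve (t_of P.1)
    & embeds_in_points ('Z_2 * 'Z_12)%type E.
Proof.
case: P => x y XP nx; have [x0 x1 xi xo xh] := and5P nx.
rewrite /on_X /= in XP x0 x1 xi xo xh *.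
have two0 : 2 != 0 :> K by rewrite fieldExt_rat_natr_eq0.
have x1' : x - 1 != 0 by apply: contraNneq x1 => /subr0_eq->; rewrite expr1n.
have xp1 : x + 1 != 0.
  by apply: contraNneq x1 => /eqP; rewrite addr_eq0 => /eqP->; rewrite sqrrN expr1n.
have x2 : 2 * x != 0 by rewrite mulf_neq0.
apply: (@modular_embedding K (t_of x) ((x - x^-1) / 2) (y / x)).
- by rewrite /t_of; field; rewrite two0 x0.
- by rewrite expr_div_n XP /t_of; field; rewrite two0 x0.
- exact: fieldExt_rat_natr_eq0.
have -> : t_of x + 2 = (x + 1) ^+ 2 / (2 * x) by rewrite /t_of; field; rewrite two0 x0.
have -> : 2 * t_of x + 1 = (x ^+ 2 - x + 1) / x by rewrite /t_of; field; rewrite two0 x0.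
have -> : t_of x - 1 = (x ^+ 2 - 4 * x + 1) / (2 * x) by rewrite /t_of; field; rewrite two0 x0.
have -> : t_of x + 1 = (x ^+ 2 + 1) / (2 * x) by rewrite /t_of; field; rewrite two0 x0.
by rewrite /t_of !mulf_neq0 ?invr_eq0 ?expf_neq0.
Qed.

Theorem theorem11 (K : fieldExtType rat) (Kbar : closedFieldType)
    (iota : {rmorphism K -> Kbar}) :
  \dim {:K} = 4%N -> algebraic_closure iota ->
  ~ exists n : nat, (0 < n)%N /\
      number_up_to (isomorphic_over iota)
        (fun E : elliptic_curve K => embeds_in_points ('Z_2 * 'Z_12)%type E) n.
Proof.
move=> dimK _ [n [n0 [c [cP _ cover]]]].
have two0 : 2 != 0 :> K by rewrite fieldExt_rat_natr_eq0.
have [f [f_inj fD]] := cP (Ordinal n0).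
have [P XP nP] := embedding_parameter two0 f_inj fD.
have [Q [XQ t_inj]] := infinitely_many_parameters dimK XP nP.
(* Every parameter t of the infinite family gives a curve with the j-invariant of some
   representative, hence a root of this nonzero product. *)
pose p := \prod_(i < n) j_poly (c4 (c i) ^+ 3) (discriminant (c i)).
have p0 : p != 0.
  by apply/prodf_neq0 => i _; apply: j_poly_neq0 => //; exact: discriminant_neq0.
have rootp k : root p (t_of (Q k).1).
  have [Xk nk] := XQ k; have [E Et /cover[i /isomorphic_over_j]] := modular_embedding_of_X Xk nk.
  rewrite Et /root => jE; rewrite /p horner_prod; apply/prodf_eq0; exists i => //.
  by rewrite j_poly_modular jE subrr.
(* A nonzero polynomial has fewer roots than its size, so [size p] distinct ones suffice. *)
pose s := mkseq (fun k => t_of (Q k).1) (size p).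
have alls : all (root p) s by apply/allP => _ /mapP[k _ ->].
have uniqs : uniq s by exact: mkseq_uniq.
by have := max_poly_roots p0 alls uniqs; rewrite size_mkseq ltnn.
Qed.
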